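(* Let $n\ge1$ and let $c,d$ be complex parameters. The two sequences (indexed by $n$-tuples $\boldsymbol k$ of nonnegative integers) \begin{align*} \alpha_{\boldsymbol k}(a,b)&:=\prod_{r=1}^n\frac{\theta(ax_rq^{k_r+|\boldsymbol k|};p)}{\theta(ax_r;p)}\cdot\frac{\prod_{1\le r<s\le n}(ax_rx_sq/d;q,p)_{k_r+k_s}}{\prod_{r,s=1}^n(qx_r/x_s;q,p)_{k_r}(ax_rx_sq/d;q,p)_{k_r}}\\ &\quad\times\frac{\prod_{r=1}^n(cx_r,\,a^2x_rq/(bcd);q,p)_{k_r}(ax_r,\,d/x_r;q,p)_{|\boldsymbol k|}}{(aq/c,\,bcd/a;q,p)_{|\boldsymbol k|}\prod_{r=1}^n(d/x_r;q,p)_{|\boldsymbol k|-k_r}}\left(\frac ba\right)^{|\boldsymbol k|} \end{align*} and \begin{align*} \beta_{\boldsymbol k}(a,b)&:=\frac{\prod_{1\le r<s\le n}(ax_rx_sq/d;q,p)_{k_r+k_s}}{\prod_{r,s=1}^n(ax_rx_sq/d;q,p)_{k_r}(qx_r/x_s;q,p)_{k_r}}\prod_{r=1}^n\frac{(bx_r,\,bd/(ax_r);q,p)_{|\boldsymbol k|}}{(bd/(ax_r);q,p)_{|\boldsymbol k|-k_r}}\cdot\frac{\prod_{r=1}^n(ax_rq/(cd),\,bcx_r/a;q,p)_{k_r}}{(aq/c,\,bcd/a;q,p)_{|\boldsymbol k|}} \end{align*} form a WP Bailey pair with respect to the matrix $\mathbf B^{(1)}$.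
   Context: Let $q,p$ be complex numbers with $q\neq 0$ and $|p|<1$. For $a\ne 0$ put $\theta(a;p)=\prod_{j\ge 0}(1-ap^j)(1-p^{j+1}/a)$. For an integer $k$ the $q,p$-shifted factorial is $(a;q,p)_k=\prod_{j=0}^{k-1}\theta(aq^j;p)$ if $k\ge 0$ (empty product $=1$), and $(a;q,p)_{k}=\big(\prod_{j=k}^{-1}\theta(aq^{j};p)\big)^{-1}$ if $k<0$. Write $(a_1,\dots,a_m;q,p)_k=(a_1;q,p)_k\cdots(a_m;q,p)_k$. For a tuple $\boldsymbol k=(k_1,\dots,k_n)$, $|\boldsymbol k|=k_1+\cdots+k_n$. The $x_1,\dots,x_n$ are fixed complex parameters. All parameters are nonzero and generic in the sense that no denominators vanish. A product sign $\prod_{r,s=1}^n$ or $\prod_{r=1}^n$ applies to all the juxtaposed factors depending on $r$ (and $s$) immediately following it. WP Bailey pair: given a matrix $\mathbf B=(B_{\boldsymbol k\boldsymbol j}(a,b))$ indexed by $n$-tuples of nonnegative integers, sequences $\alpha_{\boldsymbol N}(a,b)$ and $\beta_{\boldsymbol N}(a,b)$ form a WP Bailey pair with respect to $\mathbf B$ if for all $n$-tuples $\boldsymbol N$ of nonnegative integers $$\beta_{\boldsymbol N}(a,b)=\sum_{0\le j_r\le N_r,\ r=1,\dots,n}B_{\boldsymbol N\boldsymbol j}(a,b)\,\alpha_{\boldsymbol j}(a,b).$$ The matrix $\mathbf B^{(1)}$ has entries $$B^{(1)}_{\boldsymbol k\boldsymbol j}(a,b)=\frac{(b/a;q,p)_{|\boldsymbol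 k|-|\boldsymbol j|}}{\prod_{r,s=1}^n(q^{1+j_r-j_s}x_r/x_s;q,p)_{k_r-j_r}}\prod_{r=1}^n\frac{(bx_r;q,p)_{j_r+|\boldsymbol k|}}{(ax_rq;q,p)_{k_r+|\boldsymbol j|}}.$$ *)

(* Defs.v *)
From HB Require Import structures.
From mathcomp Require Import all_boot all_order all_algebra.
From mathcomp Require Import all_classical all_reals all_analysis.
From mathcomp Require Export complex.
Set Implicit Arguments.
Unset Strict Implicit.
Unset Printing Implicit Defensive.
Import Order.TTheory GRing.Theory Num.Theory numFieldNormedType.Exports.
Local Open Scope classical_set_scope.
Local Open Scope ring_scope.

(* The definitions are over an arbitrary numFieldType because the library
   attaches the norm topology to that structure; they are meant to be used
   over the complex numbers R[i], R : realType. *)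

(* Infinite product, as the limit of its partial products. It converges for
   `|p| < 1 and a != 0; no meaning is attached to other arguments. *)
Definition theta (K : numFieldType) (p a : K) : K :=
  lim ((fun m : nat =>
    \prod_(0 <= j < m) ((1 - a * p ^+ j) * (1 - p ^+ j.+1 / a))) @ \oo).

(* For k = Negz m = -(m+1), the factors theta (a q^j), k <= j <= -1, are
   indexed by i = -j-1, 0 <= i <= m. *)
Definition qpfact (K : numFieldType) (q p a : K) (k : int) : K :=
  match k with
  | Posz m => \prod_(0 <= j < m) theta p (a * q ^+ j)
  | Negz m => (\prod_(0 <= i < m.+1) theta p (a * q ^- i.+1))^-1
  end.

Definition multiindex (n : nat) := 'I_n -> nat.

Definition mindex_sum (n : nat) (k : multiindex n) : nat := (\sum_(r < n) k r)%N.

(* {dffun forall r, 'I_(N r).+1} is the finite type of the multi-indices j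
   with 0 <= j_r <= N_r for all r. *)
Definition WP_Bailey_pair (K : numFieldType) (n : nat)
    (B : K -> K -> multiindex n -> multiindex n -> K)
    (alpha beta : K -> K -> multiindex n -> K) (a b : K) : Prop :=
  forall N : multiindex n,
    beta a b N =
    \sum_(j : {dffun forall r : 'I_n, 'I_(N r).+1})
       B a b N (fun r => j r : nat) * alpha a b (fun r => j r : nat).

Section Sequences.
Variables (K : numFieldType) (q p : K) (n : nat) (x : 'I_n -> K).

Local Notation qp := (qpfact q p).

Definition B1 (a b : K) (k j : multiindex n) : K :=
  qp (b / a) ((mindex_sum k)%:Z - (mindex_sum j)%:Z) /
    (\prod_(r < n) \prod_(s < n)
       qp (q ^ (1 + (j r)%:Z - (j s)%:Z) * x r / x s) ((k r)%:Z - (j r)%:Z)) *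
  \prod_(r < n)
    (qp (b * x r) (j r + mindex_sum k)%N / qp (a * x r * q) (k r + mindex_sum j)%N).

Definition alpha1 (c d a b : K) (k : multiindex n) : K :=
  (\prod_(r < n) (theta p (a * x r * q ^+ (k r + mindex_sum k)) / theta p (a * x r))) *
  ((\prod_(r < n) \prod_(s < n | (r < s)%N)
      qp (a * x r * x s * q / d) (k r + k s)%N) /
   (\prod_(r < n) \prod_(s < n)
      (qp (q * x r / x s) (k r) * qp (a * x r * x s * q / d) (k r)))) *
  ((\prod_(r < n)
      (qp (c * x r) (k r) * qp (a ^+ 2 * x r * q / (b * c * d)) (k r) *
       (qp (a * x r) (mindex_sum k) * qp (d / x r) (mindex_sum k)))) /
   (qp (a * q / c) (mindex_sum k) * qp (b * c * d / a) (mindex_sum k) *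
    \prod_(r < n) qp (d / x r) ((mindex_sum k)%:Z - (k r)%:Z))) *
  (b / a) ^+ mindex_sum k.

Definition beta1 (c d a b : K) (k : multiindex n) : K :=
  ((\prod_(r < n) \prod_(s < n | (r < s)%N)
      qp (a * x r * x s * q / d) (k r + k s)%N) /
   (\prod_(r < n) \prod_(s < n)
      (qp (a * x r * x s * q / d) (k r) * qp (q * x r / x s) (k r)))) *
  (\prod_(r < n)
     (qp (b * x r) (mindex_sum k) * qp (b * d / (a * x r)) (mindex_sum k) /
      qp (b * d / (a * x r)) ((mindex_sum k)%:Z - (k r)%:Z))) *
  ((\prod_(r < n)
      (qp (a * x r * q / (c * d)) (k r) * qp (b * c * x r / a) (k r))) /
   (qp (a * q / c) (mindex_sum k) * qp (b * c * d / a) (mindex_sum k))).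

(* The genericity conditions: the denominators displayed in B1, alpha1 and
   beta1 do not vanish. For B1 only the entries with j <= k componentwise are
   constrained, as the others do not occur in a WP Bailey pair. *)
Definition B1_generic (a : K) : Prop :=
  forall k j : multiindex n, (forall r, (j r <= k r)%N) ->
  (forall r s,
     qp (q ^ (1 + (j r)%:Z - (j s)%:Z) * x r / x s) ((k r)%:Z - (j r)%:Z) != 0) /\
  (forall r, qp (a * x r * q) (k r + mindex_sum j)%N != 0).

Definition alpha1_generic (c d a b : K) : Prop :=
  forall k : multiindex n,
  [/\ forall r, theta p (a * x r) != 0,
      forall r s, qp (q * x r / x s) (k r) != 0 /\
                  qp (a * x r * x s * q / d) (k r) != 0,
      qp (a * q / c) (mindex_sum k) != 0,
      qp (b * c * d / a) (mindex_sum k) != 0 &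
      forall r, qp (d / x r) ((mindex_sum k)%:Z - (k r)%:Z) != 0].

Definition beta1_generic (c d a b : K) : Prop :=
  forall k : multiindex n,
  [/\ forall r s, qp (a * x r * x s * q / d) (k r) != 0 /\
                  qp (q * x r / x s) (k r) != 0,
      forall r, qp (b * d / (a * x r)) ((mindex_sum k)%:Z - (k r)%:Z) != 0,
      qp (a * q / c) (mindex_sum k) != 0 &
      qp (b * c * d / a) (mindex_sum k) != 0].

End Sequences.

(* Main.v *)
Require Import Defs.
From mathcomp Require Import all_boot all_order all_algebra.
From mathcomp Require Import all_classical all_reals all_analysis.
From mathcomp Require Import ring lra zify.
Import Order.TTheory GRing.Theory Num.Theory numFieldNormedType.Exports.
Local Open Scope ring_scope.
Set Implicit Arguments.
Unset Strict Implicit.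
Unset Printing Implicit Defensive.

(** Put e = aq/d, and let y run over the N_1 + ... + N_n numbers x_r q^u with
    u < N_r, indexed by the cells t = (r, u).  A multi-index j selects the cells
    with u < j_r, that is an initial segment of each geometric progression.  Every
    shifted factorial of the Bailey sum is then a product over the selected or the
    remaining cells, and the assertion becomes an identity [subset_identity]
    between a sum over all subsets I of a finite set S, with arbitrary
    parameters y_t, and a product: when y is made of geometric progressions, a
    subset I that is not a union of initial segments contains some y_t = q y_u
    without containing y_u, and its term has the factor theta(q y_u / y_t) =
    theta(1) = 0.

    The subset identity is proved by induction on the size of S, by
    interpolation in c.  The functions (x, y) |-> theta(xy) theta(x/y) have
    rank two [theta_rank_two]: they are al(x) A(y) + be(x) B(y).  With
    l^2 = ae/b, every factor theta(cu) theta(l^2 u/c) is therefore a linear form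
    in A(c/l) and B(c/l), and both sides of the identity are binary forms of
    degree |S| in these two functions.  A binary form of degree M that vanishes
    at M + 1 pairwise independent points is zero [form_eq0].  The points are
    c = 1/y_t for t in S, where only the subsets avoiding t survive and what
    remains is the identity for S minus t at (bq, c/q), and c = a q^|S|, where
    only I = S survives.

    These points are independent unless b is a zero of one of finitely many
    functions theta(ub).  The zeros of theta are isolated and both sides are
    continuous in b, so the exceptional values of b are reached as limits.

    The analysis of theta rests on products of factors 1 + O(r^j).  The rank two
    property comes from the Jacobi triple product: up to a constant, theta(z) is
    the sum of p^(t(t-1)/2) (-z)^t over the integers t, so theta(xy) theta(x/y)
    is a double sum over pairs (k, l).  The pairs with k + l even are
    (u + v, u - v), those with k + l odd are (u + v + 1, u - v), and on each
    class the summand is a function of u times a function of v. *)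

(** * Modulus and limits of complex sequences *)

(** A named copy of R[i] at the structure over which theta is defined.  It is
    kept opaque below: unfolding it sends unification into the construction of
    the complex numbers. *)
Definition complexField (R : realType) : numFieldType := R[i].

Section Modulus.
Local Open Scope complex_scope.
Local Open Scope classical_set_scope.
Variable R : realType.
Local Notation C := (complexField R).

(** The norm of R[i] takes its values in R[i]; estimates are easier with a
    modulus in the real field R, where the order is total. *)
Definition cmod (z : C) : R := Normc.normc z.

Lemma normC_cmod (z : C) : `|z| = (cmod z)%:C :> R[i].
Proof. by case: z. Qed.

Lemma cmod_ge0 (z : C) : 0 <= cmod z.
Proof. by case: z => a b; exact: sqrtr_ge0. Qed.

Lemma cmodM (z w : C) : cmod (z * w) = cmod z * cmod w.
Proof. by apply: complexI; rewrite rmorphM -!normC_cmod normrM. Qed.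

Lemma cmod1 : cmod 1 = 1.
Proof. by apply: complexI; rewrite -normC_cmod normr1. Qed.

Lemma cmod0 : cmod 0 = 0.
Proof. by apply: complexI; rewrite -normC_cmod normr0. Qed.

Lemma cmodN (z : C) : cmod (- z) = cmod z.
Proof. by apply: complexI; rewrite -!normC_cmod normrN. Qed.

Lemma cmodB (z w : C) : cmod (z - w) = cmod (w - z).
Proof. by rewrite -cmodN opprB. Qed.

Lemma cmodV (z : C) : cmod z^-1 = (cmod z)^-1.
Proof. by apply: complexI; rewrite fmorphV -!normC_cmod normfV. Qed.

Lemma cmod_eq0 (z : C) : (cmod z == 0) = (z == 0).
Proof.
by rewrite -(inj_eq (@complexI R)) -normC_cmod normr_eq0.
Qed.

Lemma cmod_gt0 (z : C) : (0 < cmod z) = (z != 0).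
Proof. by rewrite lt_def cmod_ge0 andbT cmod_eq0. Qed.

Lemma cmodX (z : C) n : cmod (z ^+ n) = cmod z ^+ n.
Proof. by elim: n => [|n IH]; rewrite ?expr0 ?cmod1 // !exprS cmodM IH. Qed.

Lemma le_cmodD (z w : C) : cmod (z + w) <= cmod z + cmod w.
Proof. by rewrite -lecR rmorphD/= -!normC_cmod; exact: ler_normD. Qed.

Lemma cmod_sum (I : Type) (s : seq I) (P : pred I) (F : I -> C) :
  cmod (\sum_(i <- s | P i) F i) <= \sum_(i <- s | P i) cmod (F i).
Proof.
elim/big_rec2: _ => [|i a b _ h]; first by rewrite cmod0.
by apply: le_trans (le_cmodD _ _) _; rewrite lerD2l.
Qed.

Lemma cmod_prod (I : Type) (s : seq I) (P : pred I) (F : I -> C) :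
  cmod (\prod_(i <- s | P i) F i) = \prod_(i <- s | P i) cmod (F i).
Proof.
by elim/big_rec2: _ => [|i a b _ <-]; rewrite ?cmod1 ?cmodM.
Qed.

Lemma cvg_cmodP T (F : set_system T) {FF : Filter F} (u : T -> C) (l : C) :
  u @ F --> l <-> (fun n => cmod (l - u n)) @ F --> (0 : R).
Proof.
split=> [/cvgrPdist_le H|/cvgrPdist_le H]; apply/cvgrPdist_le => e e0.
- have eC : (0 : C) < (e%:C : R[i]) by rewrite ltcR.
  apply: filterS (H _ eC) => t.
  by rewrite normC_cmod lecR sub0r normrN ger0_norm // cmod_ge0.
- have [e1 e2] : 0 < complex.Re (e : R[i]) /\ e = (complex.Re (e : R[i]))%:C.
    by case: e e0 => a b; rewrite ltcE /= => /andP[/eqP -> ->].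
  apply: filterS (H _ e1) => t.
  rewrite sub0r normrN ger0_norm ?cmod_ge0 // => h.
  by rewrite normC_cmod e2 lecR.
Qed.

Lemma cvg_cmod_le (u : nat -> C) (l : C) (g : nat -> R) :
  (forall n, cmod (l - u n) <= g n) -> g @ \oo --> (0 : R) -> u @ \oo --> l.
Proof.
move=> h g0; apply/cvg_cmodP; apply: (squeeze_cvgr _ _ g0); last exact: cvg_cst.
by near=> n; rewrite cmod_ge0 h.
Unshelve. all: by end_near.
Qed.

Lemma cvg_uniq (u : nat -> C) (l m : C) : u @ \oo --> l -> u @ \oo --> m -> l = m.
Proof. by move=> h k; exact: cvg_unique h k. Qed.

Lemma cvg_cmod_bound (u : nat -> C) (l z : C) (B : R) :
  u @ \oo --> l -> (forall n, cmod (z - u n) <= B) -> cmod (z - l) <= B.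
Proof.
move=> h hB; apply/ler_addgt0Pr => e e0.
move/cvg_cmodP/cvgrPdist_le: h => /(_ _ e0) [N _ /(_ N (leqnn N)) /=].
rewrite sub0r normrN (ger0_norm (cmod_ge0 _)) => h.
have := le_cmodD (z - u N) (u N - l); rewrite addrA subrK (cmodB (u N)).
by move=> /le_trans; apply; apply: lerD.
Qed.

Lemma le_Re_cmod (z : C) : `|complex.Re (z : R[i])| <= cmod z.
Proof.
by case: z => a b; rewrite /cmod -sqrtr_sqr /=; apply: ler_wsqrtr; rewrite lerDl sqr_ge0.
Qed.

Lemma le_Im_cmod (z : C) : `|complex.Im (z : R[i])| <= cmod z.
Proof.
by case: z => a b; rewrite /cmod -sqrtr_sqr /=; apply: ler_wsqrtr; rewrite lerDr sqr_ge0.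
Qed.

Lemma cmod_le_ReIm (z : C) :
  cmod z <= `|complex.Re (z : R[i])| + `|complex.Im (z : R[i])|.
Proof.
case: z => a b /=.
have -> : `|a| + `|b| = Num.sqrt ((`|a| + `|b|) ^+ 2).
  by rewrite sqrtr_sqr; apply/esym/ger0_norm/addr_ge0.
apply: ler_wsqrtr; rewrite sqrrD !real_normK ?num_real //.
by rewrite addrAC lerDl mulrn_wge0 // mulr_ge0.
Qed.

(** Completeness of the complex numbers in the form used here: the Cauchy
    condition passes to the real and imaginary parts, whose limits exist. *)
Lemma cvg_of_cauchy (u : nat -> C) (g : nat -> R) :
  g @ \oo --> (0 : R) ->
  (forall m n, (m <= n)%N -> cmod (u n - u m) <= g m) ->
  exists l : C, u @ \oo --> l.
Proof.
move=> g0 h.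
have coord (f : C -> R) : (forall z w, `|f z - f w| <= cmod (z - w)) ->
    exists l : R, (fun n => f (u n)) @ \oo --> l.
  move=> hf; apply/cvg_ex; apply/cauchy_cvgP/cauchy_exP => e e0.
  move/cvgrPdist_lt: g0 => /(_ _ e0) [N _ hN].
  exists (f (u N)); exists N => // n /= Nn.
  apply: le_lt_trans (hf _ _) _; rewrite cmodB.
  apply: le_lt_trans (h _ _ Nn) _; apply: le_lt_trans (hN N (leqnn N)).
  by rewrite /= sub0r normrN ler_norm.
have [|a /cvgrPdist_le ha] := coord (fun z => complex.Re (z : R[i])).
  by move=> [a b] [c d]; exact: (le_Re_cmod (((a +i* b) - (c +i* d)) : R[i])).
have [|b /cvgrPdist_le hb] := coord (fun z => complex.Im (z : R[i])).
  by move=> [a' b] [c d]; exact: (le_Im_cmod (((a' +i* b) - (c +i* d)) : R[i])).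
exists ((a +i* b) : R[i]); apply/cvg_cmodP/cvgrPdist_le => e e0.
have e2 : 0 < e / 2 by rewrite divr_gt0.
near=> n; rewrite sub0r normrN (ger0_norm (cmod_ge0 _)) (splitr e).
apply: (@le_trans _ _ (`|a - complex.Re (u n : R[i])| + `|b - complex.Im (u n : R[i])|)).
  by apply: le_trans (cmod_le_ReIm _) _; case: (u n).
by apply: lerD; near: n; [exact: ha|exact: hb].
Unshelve. all: by end_near.
Qed.
End Modulus.

Section SequenceLimits.
Local Open Scope classical_set_scope.
Variable K : numFieldType.

Lemma cvg_seqM (f g : nat -> K) (a b : K) :
  f @ \oo --> a -> g @ \oo --> b -> (fun n => f n * g n) @ \oo --> a * b.
Proof. exact: cvgM. Qed.

Lemma cvg_seqD (f g : nat -> K) (a b : K) :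
  f @ \oo --> a -> g @ \oo --> b -> (fun n => f n + g n) @ \oo --> a + b.
Proof. exact: cvgD. Qed.

Lemma cvg_seqB (f g : nat -> K) (a b : K) :
  f @ \oo --> a -> g @ \oo --> b -> (fun n => f n - g n) @ \oo --> a - b.
Proof. exact: cvgB. Qed.

Lemma cvg_seq_cst (a : K) : (fun n : nat => a) @ \oo --> a.
Proof. exact: cvg_cst. Qed.

End SequenceLimits.

Opaque complexField.

(** * Products whose factors tend geometrically to one *)

Section InfiniteProducts.
Local Open Scope classical_set_scope.
Variable R : realType.
Local Notation C := (complexField R).
Local Notation cmod := (@cmod R).

(** Replace the factors one at a time: each replacement costs the difference
    of two factors, times other factors that are bounded by the h j. *)
Lemma cmod_prod_sub (f g : nat -> C) (h : nat -> R) n :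
  (forall j, 1 <= h j) -> (forall j, cmod (f j) <= h j) ->
  (forall j, cmod (g j) <= h j) ->
  cmod (\prod_(0 <= j < n) f j - \prod_(0 <= j < n) g j) <=
  (\sum_(0 <= j < n) cmod (f j - g j)) * \prod_(0 <= j < n) h j.
Proof.
move=> h1 fh gh; elim: n => [|n IH].
  by rewrite !big_geq // subrr cmod0 mul0r.
rewrite !big_nat_recr //=.
set F := \prod_(0 <= j < n) f j in IH *; set G := \prod_(0 <= j < n) g j in IH *.
set S := \sum_(0 <= j < n) _ in IH *; set H := \prod_(0 <= j < n) h j in IH *.
have H0 : 0 <= H by apply: prodr_ge0 => j _; apply: le_trans (h1 j).
have S0 : 0 <= S by apply: sumr_ge0 => j _; exact: cmod_ge0.
have GH : cmod G <= H.
  rewrite cmod_prod; apply: ler_prod => j _; by rewrite cmod_ge0 gh.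
have -> : F * f n - G * g n = (F - G) * f n + G * (f n - g n) by ring.
apply: le_trans (le_cmodD _ _) _; rewrite !cmodM mulrDl; apply: lerD.
  rewrite mulrA; apply: ler_pM => //; exact: cmod_ge0.
rewrite mulrC; apply: ler_wpM2l; first exact: cmod_ge0.
apply: le_trans GH _; rewrite ler_peMr //.
Qed.

Lemma geometric_sum_le (r : R) m n : 0 <= r < 1 ->
  \sum_(m <= j < n) r ^+ j <= r ^+ m / (1 - r).
Proof.
move=> /andP[r0 r1]; have d0 : 0 < 1 - r by rewrite subr_gt0.
have [nm|mn] := leqP n m.
  by rewrite big_geq // divr_ge0 ?exprn_ge0 // ltW.
rewrite ler_pdivlMr //; suff -> : (\sum_(m <= j < n) r ^+ j) * (1 - r) = r ^+ m - r ^+ n.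
  by rewrite gerBl exprn_ge0.
elim: n mn => // n IH; rewrite ltnS leq_eqVlt => /orP[/eqP <-|mn].
  by rewrite big_nat1 exprSr; ring.
by rewrite big_nat_recr ?(ltnW mn) //= mulrDl (IH mn) exprSr; ring.
Qed.

Lemma prod_expR_le (D r : R) n : 0 <= D -> 0 <= r < 1 ->
  \prod_(0 <= j < n) (1 + D * r ^+ j) <= expR (D / (1 - r)).
Proof.
move=> D0 /andP[r0 r1].
apply: (@le_trans _ _ (expR (\sum_(0 <= j < n) D * r ^+ j))).
  rewrite expR_sum; apply: ler_prod => j _.
  by rewrite expR_ge1Dx addr_ge0 // mulr_ge0 // exprn_ge0.
rewrite ler_expR -mulr_sumr; apply: ler_wpM2l => //.
by have := @geometric_sum_le r 0 n; rewrite r0 r1 expr0 div1r; apply.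
Qed.

Lemma prod_le_of_geometric (f : nat -> C) (D r : R) j : 0 <= D -> 0 <= r ->
  cmod (f j - 1) <= D * r ^+ j -> cmod (f j) <= 1 + D * r ^+ j.
Proof.
move=> D0 r0 h; rewrite -[f j](subrK 1) addrC; apply: le_trans (le_cmodD _ _) _.
by rewrite cmod1 lerD2l.
Qed.

(** The same products with factors 1 + O(r^j) have uniformly bounded partial
    products, so a geometric bound on the differences of factors is inherited
    by the products, uniformly in n.  This gives the continuity of theta. *)
Lemma prod_geometric_sub (f g : nat -> C) (D D' r : R) n : 0 <= D -> 0 <= r < 1 ->
  (forall j, cmod (f j - 1) <= D * r ^+ j) ->
  (forall j, cmod (g j - 1) <= D * r ^+ j) ->
  (forall j, cmod (f j - g j) <= D' * r ^+ j) ->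
  cmod (\prod_(0 <= j < n) f j - \prod_(0 <= j < n) g j) <=
  D' / (1 - r) * expR (D / (1 - r)).
Proof.
move=> D0 r01 hf hg hfg; have /andP[r0 r1] := r01.
have hr j : 0 <= D * r ^+ j by rewrite mulr_ge0 // exprn_ge0.
apply: le_trans (@cmod_prod_sub f g (fun j => 1 + D * r ^+ j) n _ _ _) _.
- by move=> j; rewrite lerDl.
- by move=> j; apply: prod_le_of_geometric.
- by move=> j; apply: prod_le_of_geometric.
have D'0 : 0 <= D'.
  by have := hfg 0%N; rewrite expr0 mulr1; apply: le_trans; exact: cmod_ge0.
apply: ler_pM; last exact: prod_expR_le.
- by apply: sumr_ge0 => j _; exact: cmod_ge0.
- by apply: prodr_ge0 => j _; rewrite addr_ge0.
apply: (@le_trans _ _ (\sum_(0 <= j < n) D' * r ^+ j)).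
  by apply: ler_sum => j _.
rewrite -mulr_sumr; apply: ler_wpM2l => //.
by have := @geometric_sum_le r 0 n r01; rewrite expr0 div1r.
Qed.

(** Comparison with the product whose factors from m on are 1. *)
Lemma prod_geometric_tail (f : nat -> C) (D r : R) m n :
  0 <= D -> 0 <= r < 1 -> (forall j, cmod (f j - 1) <= D * r ^+ j) ->
  (m <= n)%N ->
  cmod (\prod_(0 <= j < n) f j - \prod_(0 <= j < m) f j) <=
  D / (1 - r) * expR (D / (1 - r)) * r ^+ m.
Proof.
move=> D0 r01 hf mn; have /andP[r0 r1] := r01.
have hr j : 0 <= D * r ^+ j by rewrite mulr_ge0 // exprn_ge0.
pose g j := if (j < m)%N then f j else 1.
have -> : \prod_(0 <= j < m) f j = \prod_(0 <= j < n) g j.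
  rewrite (big_cat_nat (leq0n m) mn) //= [X in _ = _ * X](_ : _ = 1) ?mulr1; last first.
    by rewrite big_nat_cond; apply: big1 => j /andP[/andP[mj _] _]; rewrite /g ltnNge mj.
  by apply: eq_big_nat => j /andP[_ jm]; rewrite /g jm.
apply: le_trans (@cmod_prod_sub f g (fun j => 1 + D * r ^+ j) n _ _ _) _.
- by move=> j; rewrite lerDl.
- by move=> j; apply: prod_le_of_geometric.
- move=> j; rewrite /g; case: ifP => _; first by apply: prod_le_of_geometric.
  by rewrite cmod1 lerDl.
rewrite mulrAC; apply: ler_pM; last exact: prod_expR_le.
- by apply: sumr_ge0 => j _; exact: cmod_ge0.
- by apply: prodr_ge0 => j _; rewrite addr_ge0.
rewrite (big_cat_nat (leq0n m) mn) //= [X in X + _](_ : _ = 0) ?add0r; last first.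
  rewrite big_nat_cond; apply: big1 => j /andP[/andP[_ jm] _].
  by rewrite /g jm subrr cmod0.
apply: (@le_trans _ _ (\sum_(m <= j < n) D * r ^+ j)).
  by apply: ler_sum_nat => j /andP[mj _]; rewrite /g ltnNge mj /=.
by rewrite -mulr_sumr mulrAC -mulrA; apply: ler_wpM2l => //; exact: geometric_sum_le.
Qed.

Lemma cvg_geometric0 (D r : R) : 0 <= r < 1 -> (fun m => D * r ^+ m) @ \oo --> (0 : R).
Proof. by move=> /andP[r0 r1]; apply: cvg_geometric; rewrite ger0_norm. Qed.

Lemma prod_geometric_cvg (f : nat -> C) (D r : R) : 0 <= D -> 0 <= r < 1 ->
  (forall j, cmod (f j - 1) <= D * r ^+ j) ->
  exists L : C, (fun n => \prod_(0 <= j < n) f j) @ \oo --> L.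
Proof.
move=> D0 r01 hf; apply: (@cvg_of_cauchy _ _ (fun m => D / (1 - r) * expR (D / (1 - r)) * r ^+ m)).
  exact: cvg_geometric0.
by move=> m n mn; exact: prod_geometric_tail.
Qed.

(** A tail of the product is within 1 of 1, hence its limit is nonzero; the
    finitely many remaining factors are nonzero by hypothesis. *)
Lemma prod_geometric_neq0 (f : nat -> C) (D r : R) (L : C) : 0 <= D -> 0 <= r < 1 ->
  (forall j, cmod (f j - 1) <= D * r ^+ j) -> (forall j, f j != 0) ->
  (fun n => \prod_(0 <= j < n) f j) @ \oo --> L -> L != 0.
Proof.
move=> D0 r01 hf f0 fL; have /andP[r0 r1] := r01.
have [N _ hN] : \forall m \near \oo, D / (1 - r) * expR (D / (1 - r)) * r ^+ m < 1.
  have /cvgrPdist_lt /(_ 1 ltr01) := @cvg_geometric0 (D / (1 - r) * expR (D / (1 - r))) r r01.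
  by apply: filterS => m; rewrite sub0r normrN; apply: le_lt_trans; exact: ler_norm.
have {hN} hN := hN N (leqnn N).
pose g j := f (j + N)%N.
have hg j : cmod (g j - 1) <= (D * r ^+ N) * r ^+ j.
  by rewrite -mulrA -exprD addnC; exact: hf.
have DN : 0 <= D * r ^+ N by rewrite mulr_ge0 // exprn_ge0.
have [L' gL'] := prod_geometric_cvg DN r01 hg.
have LE : L = \prod_(0 <= j < N) f j * L'.
  apply: (@cvg_uniq _ (fun n => \prod_(0 <= j < n + N) f j)).
    by move: fL; rewrite -(cvg_shiftn N).
  have -> : (fun n => \prod_(0 <= j < n + N) f j) =
      (fun n => \prod_(0 <= j < N) f j * \prod_(0 <= j < n) g j).
    apply/funext => n; rewrite (@big_cat_nat _ _ _ N 0) ?leq_addl //=; congr (_ * _).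
    by rewrite -{1}[N]add0n big_addn addnK.
  apply: cvg_seqM; [exact: cvg_seq_cst|exact: gL'].
rewrite LE mulf_neq0 //; first by rewrite prodf_seq_neq0; apply/allP => j _; exact: f0.
apply/eqP => L0.
suff hB n : cmod (1 - \prod_(0 <= j < n) g j) <=
    D / (1 - r) * expR (D / (1 - r)) * r ^+ N.
  by have := cvg_cmod_bound gL' hB; rewrite L0 subr0 cmod1 leNgt hN.
rewrite cmodB.
have := @prod_geometric_tail g (D * r ^+ N) r 0 n DN r01 hg (leq0n n).
rewrite [\prod_(0 <= j < 0) _]big_geq // expr0 mulr1 => /le_trans; apply.
have d0 : 0 <= (1 - r)^-1 by rewrite invr_ge0 subr_ge0 ltW.
have -> : D * r ^+ N / (1 - r) = D / (1 - r) * r ^+ N by ring.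
rewrite [leRHS]mulrAC; apply: ler_wpM2l; first by rewrite !mulr_ge0 // exprn_ge0.
rewrite ler_expR -[leRHS]mulr1; apply: ler_wpM2l; first by rewrite mulr_ge0.
by rewrite exprn_ile1 // ltW.
Qed.
End InfiniteProducts.

(** * Theta as a convergent product *)

Section Theta.
Local Open Scope classical_set_scope.
Variable R : realType.
Local Notation C := (complexField R).
Local Notation cmod := (@cmod R).
Variable p : C.
Hypothesis p_lt1 : cmod p < 1.

Let r01 : 0 <= cmod p < 1.
Proof. by rewrite cmod_ge0. Qed.

Let r0 : 0 <= cmod p := cmod_ge0 p.

Definition theta_factor (a : C) (j : nat) : C := (1 - a * p ^+ j) * (1 - p ^+ j.+1 / a).

Let theta_bound (a : C) : R := cmod a + (cmod a)^-1 + 1.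

Lemma theta_bound_ge0 a : 0 <= theta_bound a.
Proof. by rewrite !addr_ge0 ?invr_ge0 ?cmod_ge0. Qed.

Lemma theta_factor_bound a j :
  cmod (theta_factor a j - 1) <= theta_bound a * cmod p ^+ j.
Proof.
(* a / a stands for 1, so that the equation also holds for a = 0. *)
have -> : theta_factor a j - 1 =
    - (a * p ^+ j) + (- (p ^+ j.+1 / a) + (a / a) * (p ^+ j.+1 * p ^+ j)).
  by rewrite /theta_factor; ring.
have rj : 0 <= cmod p ^+ j by rewrite exprn_ge0.
have rj1 : cmod p ^+ j <= 1 by rewrite exprn_ile1 // ltW.
have rS : cmod p ^+ j.+1 <= cmod p ^+ j by rewrite exprS ler_piMl // ltW.
rewrite /theta_bound -addrA mulrDl.
apply: le_trans (le_cmodD _ _) _; rewrite cmodN cmodM cmodX lerD2l mulrDl.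
apply: le_trans (le_cmodD _ _) _; rewrite cmodN !cmodM !cmodX !cmodV mulrC.
apply: lerD; first by rewrite ler_wpM2l // invr_ge0 cmod_ge0.
have h1 : cmod a / cmod a <= 1.
  by have [->|a0] := eqVneq (cmod a) 0; rewrite ?mul0r ?ler01 // divff.
apply: ler_pM => //; rewrite ?divr_ge0 ?cmod_ge0 ?mulr_ge0 ?exprn_ge0 //.
rewrite -[leRHS]mul1r; apply: ler_pM; rewrite ?exprn_ge0 //.
exact: le_trans rS _.
Qed.

Definition theta_partial (a : C) (m : nat) : C := \prod_(0 <= j < m) theta_factor a j.

Lemma theta_cvg a : theta_partial a @ \oo --> theta p a.
Proof.
have [l hl] := prod_geometric_cvg (theta_bound_ge0 a) r01 (theta_factor_bound a).
suff -> : theta p a = l by [].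
exact: (cvg_lim _ hl).
Qed.

Lemma theta1 : theta p 1 = 0.
Proof.
apply: cvg_uniq (@theta_cvg 1) _.
apply/cvg_cmodP/cvgrPdist_le => e e0; exists 1%N => // m /= m1.
rewrite /theta_partial big_ltn // /theta_factor expr0 mulr1 subrr !mul0r subrr.
by rewrite cmod0 subrr normr0 ltW.
Qed.

(** Inversion exchanges the two families of factors up to a shift of the index
    by one, so only the end factors survive in the quotient. *)
Lemma theta_partialV (a : C) m : a != 0 ->
  theta_partial a^-1 m * ((1 - a) * (1 - p ^+ m / a)) =
  - a^-1 * theta_partial a m * ((1 - a) * (1 - a * p ^+ m)).
Proof.
move=> a0; rewrite /theta_partial; elim: m => [|m IH].
  by rewrite !big_geq // expr0 mulr1 !mul1r; field.
rewrite !big_nat_recr //=.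
set T := \prod_(0 <= j < m) _ in IH *; set T' := \prod_(0 <= j < m) _ in IH *.
rewrite {1}/theta_factor invrK.
have -> : T * ((1 - a^-1 * p ^+ m) * (1 - p ^+ m.+1 * a)) *
  ((1 - a) * (1 - p ^+ m.+1 / a)) = (T * ((1 - a) * (1 - p ^+ m / a))) *
  ((1 - p ^+ m.+1 * a) * (1 - p ^+ m.+1 / a)) by ring.
by rewrite IH /theta_factor; ring.
Qed.

Lemma cvg_expr0 (z : C) : (fun m => z * p ^+ m) @ \oo --> (0 : C).
Proof.
apply: (@cvg_cmod_le _ _ _ (fun m => cmod z * cmod p ^+ m)).
  by move=> m; rewrite sub0r cmodN cmodM cmodX.
exact: cvg_geometric0.
Qed.

Lemma thetaV (a : C) : a != 0 -> theta p a^-1 = - a^-1 * theta p a.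
Proof.
move=> a0; have [->|a1] := eqVneq a 1; first by rewrite invr1 theta1 mulr0.
have d0 : (1 - a : C) != 0 by rewrite subr_eq0 eq_sym.
apply: (mulIf d0).
have lim1 (z : C) : (fun m => (1 - a) * (1 - z * p ^+ m)) @ \oo --> (1 - a : C).
  rewrite -[X in _ --> X]mulr1 -[X in _ --> (1 - a) * X]subr0.
  apply: cvg_seqM; first exact: cvg_seq_cst.
  apply: cvg_seqB; [exact: cvg_seq_cst|exact: cvg_expr0].
have h1 := cvg_seqM (@theta_cvg a^-1) (lim1 a^-1).
suff h2 : (fun n => theta_partial a^-1 n * ((1 - a) * (1 - a^-1 * p ^+ n))) @ \oo -->
    (- a^-1 * theta p a * (1 - a) : C) by exact: cvg_uniq h1 h2.
have -> : (fun n => theta_partial a^-1 n * ((1 - a) * (1 - a^-1 * p ^+ n))) =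
   (fun n => - a^-1 * theta_partial a n * ((1 - a) * (1 - a * p ^+ n))).
  by apply/funext => m; rewrite -theta_partialV // [p ^+ m / a]mulrC.
apply: cvg_seqM; last exact: lim1.
apply: cvg_seqM; [exact: cvg_seq_cst|exact: theta_cvg].
Qed.

(** The zeros are those of the factors: the nonzero factors make a nonzero
    product. *)
Lemma theta_eq0 (a : C) : a != 0 -> theta p a = 0 ->
  exists j, a * p ^+ j = 1 \/ a = p ^+ j.+1.
Proof.
move=> a0 ta; apply: contrapT => /forallNP h.
have := prod_geometric_neq0 (theta_bound_ge0 a) r01 (theta_factor_bound a) _ (@theta_cvg a).
rewrite ta eqxx => /(_ _)/negP; case=> //; move=> j.
have /not_orP[h1 h2] := h j.
rewrite /theta_factor mulf_neq0 //; first by rewrite subr_eq0 eq_sym; apply/eqP.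
rewrite subr_eq0 eq_sym; apply/eqP => e; apply: h2.
by rewrite -[LHS]mul1r -e divfK.
Qed.

Lemma theta_lipschitz (a b : C) : a != 0 -> b != 0 ->
  forall D, theta_bound a <= D -> theta_bound b <= D ->
  cmod (theta p a - theta p b) <=
  cmod (a - b) * (1 + (cmod a)^-1 * (cmod b)^-1) / (1 - cmod p) * expR (D / (1 - cmod p)).
Proof.
move=> a0 b0 D aD bD.
have D0 : 0 <= D := le_trans (theta_bound_ge0 a) aD.
have rj j : 0 <= cmod p ^+ j by rewrite exprn_ge0.
have h m : cmod (theta_partial a m - theta_partial b m) <=
  cmod (a - b) * (1 + (cmod a)^-1 * (cmod b)^-1) / (1 - cmod p) * expR (D / (1 - cmod p)).
  apply: prod_geometric_sub => // j.
  - by apply: le_trans (theta_factor_bound _ _) _; rewrite ler_wpM2r.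
  - by apply: le_trans (theta_factor_bound _ _) _; rewrite ler_wpM2r.
  have -> : theta_factor a j - theta_factor b j =
    - ((a - b) * p ^+ j) + p ^+ j.+1 * ((a - b) * (a^-1 * b^-1)).
    by rewrite /theta_factor; field; rewrite b0 a0.
  apply: le_trans (le_cmodD _ _) _; rewrite cmodN !cmodM !cmodV !cmodX.
  rewrite mulrDr mulr1 mulrDl lerD2l [leLHS]mulrC; apply: ler_wpM2l.
    by rewrite !mulr_ge0 ?invr_ge0 ?cmod_ge0.
  by rewrite exprS ler_piMl // ltW.
have lim := cvg_seqB (@theta_cvg a) (@theta_cvg b).
have hB m : cmod (0 - (theta_partial a m - theta_partial b m)) <=
  cmod (a - b) * (1 + (cmod a)^-1 * (cmod b)^-1) / (1 - cmod p) * expR (D / (1 - cmod p)).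
  by rewrite sub0r cmodN.
by have := cvg_cmod_bound lim hB; rewrite sub0r cmodN.
Qed.

Lemma near_cmod (a : C) (e : R) : 0 < e -> \forall b \near a, cmod (a - b) <= e.
Proof.
move=> e0; have : (fun b : C => b) @ a --> a by exact: cvg_id.
move/cvg_cmodP/cvgrPdist_le => /(_ _ e0); apply: filterS => b.
by rewrite sub0r normrN ger0_norm ?cmod_ge0.
Qed.

Lemma theta_continuous (a : C) : a != 0 -> {for a, continuous (theta p)}.
Proof.
move=> a0; have ca : 0 < cmod a by rewrite cmod_gt0.
pose D := 2 * cmod a + 2 * (cmod a)^-1 + 1.
pose L := (1 + (cmod a)^-1 * (2 * (cmod a)^-1)) / (1 - cmod p) * expR (D / (1 - cmod p)).
have d0 : 0 < 1 - cmod p by rewrite subr_gt0.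
have ca' : 0 < (cmod a)^-1 by rewrite invr_gt0.
have L0 : 0 < L by rewrite mulr_gt0 ?expR_gt0 // divr_gt0 // addr_gt0 // !mulr_gt0.
have FF : Filter (nbhs a) by exact: nbhs_filter.
apply: (iffRL (@cvg_cmodP _ _ _ FF _ _)); apply/cvgrPdist_le => e e0.
(* Within |a|/2 of a the modulus lies between |a|/2 and 2|a|: hence D and L. *)
near=> b.
have hb : cmod (a - b) <= cmod a / 2.
  by near: b; apply: near_cmod; rewrite divr_gt0.
have he : cmod (a - b) <= e / L.
  by near: b; apply: near_cmod; rewrite divr_gt0.
have b1 : cmod a / 2 <= cmod b.
  by have := le_cmodD (a - b) b; rewrite subrK; lra.
have b2 : cmod b <= 2 * cmod a.
  by have := le_cmodD (b - a) a; rewrite subrK (cmodB b); lra.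
have cb : 0 < cmod b by apply: lt_le_trans b1; rewrite divr_gt0.
have b3 : (cmod b)^-1 <= 2 * (cmod a)^-1.
  by rewrite -[2]invrK -invfM lef_pV2 ?posrE ?mulr_gt0 ?invr_gt0 // mulrC.
have b0 : b != 0 by rewrite -cmod_gt0.
rewrite sub0r normrN (ger0_norm (cmod_ge0 _)).
apply: le_trans (theta_lipschitz a0 b0 (_ : _ <= D) (_ : _ <= D)) _.
- by rewrite /theta_bound /D; lra.
- by rewrite /theta_bound /D; lra.
apply: (@le_trans _ _ (cmod (a - b) * L)); last first.
  by rewrite -ler_pdivlMr.
rewrite /L -!mulrA; apply: ler_wpM2l; first exact: cmod_ge0.
rewrite !mulrA; apply: ler_wpM2r; first exact: expR_ge0.
apply: ler_wpM2r; first by rewrite invr_ge0 ltW.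
by rewrite lerD2l -[leRHS]mulrA; apply: ler_wpM2l => //; exact: ltW.
Unshelve. all: by end_near.
Qed.

End Theta.

(** * Zeros of theta *)

Section Near.
Local Open Scope classical_set_scope.
Variable R : realType.
Local Notation C := (complexField R).
Local Notation cmod := (@cmod R).
Variable p : C.
Hypothesis p_lt1 : cmod p < 1.

(** The zeros are powers of p with exponents of both signs; writing the ratio
    of two zeros with a natural exponent avoids inverting p, which may be 0. *)
Lemma theta_zeros_ratio (a b : C) : a != 0 -> b != 0 ->
  theta p a = 0 -> theta p b = 0 -> exists m, a = b * p ^+ m \/ b = a * p ^+ m.
Proof.
have half i j (a' b' : C) : (i <= j)%N -> a' * p ^+ i = 1 -> b' * p ^+ j = 1 ->
    a' = b' * p ^+ (j - i).
  move=> ij ha hb; have pi0 : p ^+ i != 0.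
    by apply/eqP => h; move: ha; rewrite h mulr0 => /eqP; rewrite eq_sym oner_eq0.
  by apply: (mulIf pi0); rewrite ha -mulrA -exprD subnK.
move=> a0 b0 /(theta_eq0 p_lt1 a0)[i hi] /(theta_eq0 p_lt1 b0)[j hj].
case: hi => hi; case: hj => hj.
- case/orP: (leq_total i j) => ij.
    by exists (j - i)%N; left; apply: half.
  by exists (i - j)%N; right; apply: half.
- by exists (i + j.+1)%N; right; rewrite exprD mulrA hi mul1r.
- by exists (j + i.+1)%N; left; rewrite exprD mulrA hj mul1r.
case/orP: (leq_total i j) => ij.
  by exists (j - i)%N; right; rewrite hi -exprD hj addSn subnKC.
by exists (i - j)%N; left; rewrite hi hj -exprD addSn subnKC.
Qed.

Lemma theta_scale_continuous (a b : C) : a != 0 -> b != 0 ->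
  {for b, continuous (fun z => theta p (a * z))}.
Proof.
move=> a0 b0; apply: (@continuous_comp _ _ _ (fun z : C => a * z) (theta p)).
  by apply: continuousM; [exact: cst_continuous|move=> P; exact].
by apply: theta_continuous => //; rewrite mulf_neq0.
Qed.

(** Two zeros that differ have moduli whose ratio is at most |p| or at least
    1/|p|, so a zero is isolated. *)
Lemma theta_neq0_near (a b : C) : a != 0 -> b != 0 ->
  \forall z \near b, z != b -> theta p (a * z) != 0.
Proof.
move=> a0 b0; have FF : Filter (nbhs b) by exact: nbhs_filter.
have [tb|tb] := eqVneq (theta p (a * b)) 0; last first.
  have := theta_scale_continuous a0 b0.
  move=> /(@cvgr_neq0 _ C _ _ FF _ _) /(_ tb).
  by apply: filterS => z h _.
have cb : 0 < cmod b by rewrite cmod_gt0.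
have r0 := cmod_ge0 p.
pose e := cmod b * (1 - cmod p) / 2.
have e0 : 0 < e by rewrite divr_gt0 // mulr_gt0 // subr_gt0.
near=> z => zb; apply/eqP => tz.
have hz : cmod (b - z) <= e by near: z; exact: near_cmod.
have hz1 : cmod b <= cmod z + e.
  by have := le_cmodD (b - z) z; rewrite subrK; lra.
have hz2 : cmod z <= cmod b + e.
  by have := le_cmodD (z - b) b; rewrite subrK (cmodB z); lra.
have [E1 E2] : e < cmod b /\ 2 * e = cmod b - cmod p * cmod b.
  by rewrite /e; split; [nra|field].
have z0 : z != 0 by rewrite -cmod_gt0; lra.
have azn : a * z != 0 by rewrite mulf_neq0.
have abn : a * b != 0 by rewrite mulf_neq0.
have small (u v : C) m : a * u = a * v * p ^+ m.+1 -> cmod u <= cmod p * cmod v.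
  rewrite -mulrA => /(mulfI a0) ->; rewrite cmodM cmodX mulrC exprS.
  apply: ler_wpM2r; rewrite ?cmod_ge0 // ler_piMr // exprn_ile1 // ltW //.
have [[|m] [] h] := theta_zeros_ratio azn abn tz tb.
- by move: h; rewrite expr0 mulr1 => /(mulfI a0) /eqP; rewrite (negbTE zb).
- by move: h; rewrite expr0 mulr1 => /(mulfI a0) /eqP; rewrite eq_sym (negbTE zb).
- by have := small _ _ _ h; nra.
- by have := small _ _ _ h; nra.
Unshelve. all: by end_near.
Qed.

Lemma eq0_of_continuous (f : C -> C) (b : C) : {for b, continuous f} ->
  (\forall z \near b, z != b -> f z = 0) -> f b = 0.
Proof.
move=> fc h.
have FF : ProperFilter (b^') by exact: Proper_dnbhs_numFieldType.
have h1 : f @ b^' --> f b.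
  by move=> A /fc hA; exact: (@nbhs_dnbhs C b _ hA).
have h2 : f @ b^' --> (0 : C).
  move=> A hA; change (nbhs b (fun z => z != b -> A (f z))).
  apply: filterS h => z hz zb; rewrite hz //.
  exact: nbhs_singleton hA.
exact: (cvg_unique _ h1 h2).
Qed.

End Near.

(** * Gaussian bounds over the integers *)

Section GaussianBounds.
Local Open Scope classical_set_scope.
Variable R : realType.
Local Notation C := (complexField R).
Local Notation cmod := (@cmod R).

Definition zrange (m : nat) : seq int := [seq i%:Z - m%:Z | i <- iota 0 (2 * m).+1].

Lemma mem_zrange m k : (k \in zrange m) = (absz k <= m)%N.
Proof.
apply/mapP/idP; first by case=> i; rewrite mem_iota => hi ->; lia.
move=> km.
by exists (absz (k + m%:Z)); [rewrite mem_iota|]; lia.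
Qed.

Lemma zrange_uniq m : uniq (zrange m).
Proof. by rewrite map_inj_uniq ?iota_uniq // => i j; lia. Qed.

Lemma size_zrange m : size (zrange m) = (2 * m).+1.
Proof. by rewrite size_map size_iota. Qed.

(** The exponent of p in the triple product; t(t-1) is even, so the quotient is
    exact. *)
Definition triangle (t : int) : int := ((t * (t - 1)) %/ 2)%Z.

Lemma triangleE t : triangle t * 2 = t * (t - 1).
Proof.
have [u hu] : exists u : int, t = 2 * u \/ t = 2 * u + 1.
  by exists (t %/ 2)%Z; lia.
case: hu => ->.
  rewrite /triangle (_ : 2 * u * (2 * u - 1) = (u * (2 * u - 1)) * 2); last by ring.
  by rewrite mulzK.
rewrite /triangle (_ : (2 * u + 1) * (2 * u + 1 - 1) = ((2 * u + 1) * u) * 2); last by ring.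
by rewrite mulzK.
Qed.

Lemma cmodXz (z : C) (t : int) : cmod (z ^ t) = cmod z ^ t.
Proof.
case: t => n; first by rewrite -!exprnP cmodX.
by rewrite !NegzE -!exprz_inv -!exprnP cmodX cmodV.
Qed.

Lemma ler_sum_size (I : Type) (s : seq I) (P : pred I) (F : I -> R) (K : R) : 0 <= K ->
  (forall i, P i -> F i <= K) -> \sum_(i <- s | P i) F i <= (size s)%:R * K.
Proof.
move=> K0 h; elim: s => [|i s IH]; first by rewrite big_nil mul0r.
rewrite big_cons /= -natr1 mulrDl mul1r; case: ifP => [Pi|_].
  by rewrite addrC; apply: lerD => //; exact: h.
by apply: le_trans IH _; rewrite lerDl.
Qed.

Lemma ler_sum_size_seq (I : eqType) (s : seq I) (F : I -> R) (K : R) :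
  (forall i, i \in s -> F i <= K) -> \sum_(i <- s) F i <= (size s)%:R * K.
Proof.
elim: s => [|i s IH] h; first by rewrite big_nil mul0r.
rewrite big_cons /= -natr1 mulrDl mul1r addrC; apply: lerD.
  by apply: IH => j js; apply: h; rewrite inE js orbT.
by apply: h; rewrite inE eqxx.
Qed.

(** With r = s^4, the factor (2m+1) s^m is bounded, because m s^m is at most
    the sum of the s^j for j < m. *)
Lemma cvg_square_geometric (r K : R) : 0 < r < 1 -> 0 <= K ->
  (fun m => ((2 * m).+1%:R) ^+ 2 * (K * r ^+ m)) @ \oo --> (0 : R).
Proof.
move=> /andP[r0 r1] K0; pose s := Num.sqrt (Num.sqrt r).
have s0 : 0 < s by rewrite !sqrtr_gt0.
have s1 : s < 1 by rewrite -[ltRHS]sqrtr1 ltr_sqrt // -[ltRHS]sqrtr1 ltr_sqrt.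
have sr : r = s ^+ 4.
  by rewrite (exprM s 2 2) sqr_sqrtr ?sqrtr_ge0 // sqr_sqrtr // ltW.
have d0 : 0 < 1 - s by rewrite subr_gt0.
have hs m : m.+1%:R * s ^+ m <= (1 - s)^-1.
  have := @geometric_sum_le R s 0 m.+1; rewrite ltW //= s1 expr0 div1r => /(_ isT).
  apply: le_trans; have -> : m.+1%:R = \sum_(0 <= j < m.+1) (1 : R).
    by rewrite sumr_const_nat subn0.
  rewrite mulr_suml; apply: ler_sum_nat => i /andP[_ im]; rewrite mul1r.
  by apply: ler_wiXn2l; rewrite ?(ltW s0) ?(ltW s1) // -ltnS.
have h2 m : (2 * m).+1%:R * s ^+ m <= 2 * (1 - s)^-1.
  apply: (@le_trans _ _ (2 * (m.+1%:R * s ^+ m))); last by rewrite ler_wpM2l.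
  rewrite mulrA -natrM; apply: ler_wpM2r; first by rewrite exprn_ge0 // ltW.
  by rewrite ler_nat; lia.
have lim : (fun m => (K * (2 * (1 - s)^-1) ^+ 2) * s ^+ m) @ \oo --> (0 : R).
  by apply: cvg_geometric0; rewrite ltW.
apply: (squeeze_cvgr _ _ lim); last exact: cvg_cst.
near=> m; apply/andP; split.
  by rewrite !mulr_ge0 ?exprn_ge0 // ltW.
rewrite sr -exprM (_ : 4 * m = m + m + m + m)%N; last by lia.
rewrite !exprD.
rewrite (_ : _ * _ = K * ((2 * m).+1%:R * s ^+ m) ^+ 2 * s ^+ m * s ^+ m); last by ring.
rewrite -[leRHS]mulr1; have sm0 : 0 <= s ^+ m by rewrite exprn_ge0 // ltW.
apply: ler_pM => //; first by rewrite !mulr_ge0 // sqr_ge0.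
  apply: ler_wpM2r => //; apply: ler_wpM2l => //.
  by apply: lerXn2r; rewrite ?nnegrE ?mulr_ge0 ?invr_ge0 // ltW.
by rewrite exprn_ile1 // ltW.
Unshelve. all: by end_near.
Qed.

Variable p : C.
Hypothesis p_lt1 : cmod p < 1.
Hypothesis p_neq0 : p != 0.

Let r := cmod p.
Let r_gt0 : 0 < r. Proof. by rewrite /r cmod_gt0. Qed.
Let r01 : 0 <= r < 1. Proof. by rewrite /r cmod_ge0. Qed.

(** A quadratic exponent of p beats any power of w.  With r = |p| and s such
    that r^s is at most |w| and 1/|w|, the modulus is at most r^(E t - s|t|),
    and E t - (s + 1)|t| is bounded below by -(s + 3)^2. *)
Lemma gaussian_bound (E : int -> int) (w : C) : w != 0 ->
  (forall t, t * t - 3 * (absz t)%:Z <= 2 * E t) ->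
  exists2 B, 0 <= B & forall t, cmod (p ^ E t * w ^ t) <= B * r ^+ absz t.
Proof.
move=> w0 hE; have w1 : 0 < cmod w by rewrite cmod_gt0.
have [s [hs1 hs2]] : exists s : nat, r ^+ s <= cmod w /\ r ^+ s <= (cmod w)^-1.
  have /cvgrPdist_le h := @cvg_geometric0 R 1 r r01.
  have [N _ hN] : \forall m \near \oo, r ^+ m <= cmod w /\ r ^+ m <= (cmod w)^-1.
    near=> m; have hm x : 0 < x -> `|0 - 1 * r ^+ m| <= x -> r ^+ m <= x.
      by move=> x0; rewrite sub0r normrN mul1r; apply: le_trans; exact: ler_norm.
    split; apply: hm; rewrite ?invr_gt0 //; near: m; apply: h; by rewrite ?invr_gt0.
  by exists N; exact: hN N (leqnn N).
pose x := r^-1.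
have x1 : 1 <= x by rewrite /x invf_ge1 // ltW //; case/andP: r01.
have x0 : x != 0 by rewrite invr_eq0 gt_eqF.
have rx n : r ^+ n = x ^ (- n%:Z) by rewrite /x -exprz_inv invrK.
have wt t : cmod w ^ t <= x ^ (s%:Z * (absz t)%:Z).
  have ub (y : R) n : 0 < y -> r ^+ s <= y^-1 -> y ^+ n <= x ^ (s%:Z * n%:Z).
    move=> y0 hy; rewrite -exprz_exp -!exprnP; apply: lerXn2r;
      rewrite ?nnegrE ?exprn_ge0 ?invr_ge0 ?(ltW r_gt0) ?(ltW y0) //.
    by rewrite /x exprVn -[leLHS]invrK lef_pV2 ?posrE ?exprn_gt0 ?invr_gt0.
  case: t => n; first exact: ub.
  rewrite NegzE abszN -exprz_inv -exprnP; apply: ub; by rewrite ?invr_gt0 ?invrK.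
exists (x ^ ((s%:Z + 3) ^+ 2)); first by rewrite exprz_ge0 // (le_trans ler01).
move=> t; rewrite cmodM !cmodXz -/r rx.
have -> : r ^ E t = x ^ (- E t) by rewrite /x -exprz_inv invrK.
apply: (@le_trans _ _ (x ^ (- E t) * x ^ (s%:Z * (absz t)%:Z))).
  by apply: ler_wpM2l; rewrite ?exprz_ge0 ?(le_trans ler01).
rewrite -!expfzDr //; apply: ler_weXz2l => //.
have := hE t; nia.
Unshelve. all: by end_near.
Qed.

End GaussianBounds.

(** * The finite Jacobi triple product *)

Section QBinomial.
Variable K : fieldType.
Variable p : K.

Definition euler (n : nat) : K := \prod_(0 <= j < n) (1 - p ^+ j.+1).

Hypothesis p_unity : forall n, 1 - p ^+ n.+1 != 0.

Lemma eulerS n : euler n.+1 = euler n * (1 - p ^+ n.+1).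
Proof. by rewrite /euler big_nat_recr. Qed.

Lemma euler0 : euler 0 = 1.
Proof. by rewrite /euler big_geq. Qed.

Lemma euler_neq0 n : euler n != 0.
Proof. by rewrite /euler prodf_seq_neq0; apply/allP => j _; exact: p_unity. Qed.

Definition qbinom (n k : nat) : K := euler n / (euler k * euler (n - k)).

Lemma qbinomn0 n : qbinom n 0 = 1.
Proof. by rewrite /qbinom subn0 euler0 mul1r divff // euler_neq0. Qed.

Lemma qbinomnn n : qbinom n n = 1.
Proof.
by rewrite /qbinom subnn euler0 mulr1 divff // euler_neq0.
Qed.

Lemma qbinom_pascal n k : (k < n)%N ->
  qbinom n.+1 k.+1 = qbinom n k.+1 + qbinom n k * p ^+ (n - k).
Proof.
move=> kn; rewrite /qbinom subSS.
have -> : (n - k = (n - k.+1).+1)%N by lia.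
have := euler_neq0 (n - k.+1); have := euler_neq0 k.
have := p_unity (n - k.+1); have := p_unity k.
rewrite !eulerS.
have -> : p ^+ n.+1 = p ^+ k.+1 * p ^+ (n - k.+1).+1.
  by rewrite -exprD; congr (_ ^+ _); lia.
move=> h1 h2 h3 h4; field.
by rewrite h1 h2 h3 h4.
Qed.

(** The q-binomial theorem, with d k standing for (-z)^k p^(k(k-1)/2); only the
    recurrence of d is used. *)
Lemma cauchy_binomial (d : nat -> K) (z : K) n : d 0 = 1 ->
  (forall k, d k.+1 = - z * p ^+ k * d k) ->
  \prod_(0 <= j < n) (1 - z * p ^+ j) = \sum_(0 <= k < n.+1) qbinom n k * d k.
Proof.
move=> d0 dS; elim: n => [|n IH].
  by rewrite big_geq // big_nat1 qbinomn0 d0 mulr1.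
rewrite big_nat_recr //= IH [RHS]big_nat_recl // [in RHS]big_nat_recr //=.
rewrite mulrBr mulr1 [in X in X - _]big_nat_recl // qbinomn0 !qbinomnn.
rewrite mulr_suml big_nat_recr //= qbinomnn.
rewrite [in RHS](eq_big_nat _ _ (F2 := fun k => qbinom n k.+1 * d k.+1 +
   qbinom n k * p ^+ (n - k) * d k.+1)); last first.
  by move=> k /andP[_ kn]; rewrite qbinom_pascal // mulrDl.
rewrite big_split /= -addrA; rewrite -!addrA; congr (_ + (_ + _)).
  by rewrite qbinomn0.
rewrite opprD; congr (_ + _); last by rewrite dS; ring.
rewrite -sumrN; apply: eq_big_nat => k /andP[_ kn].
rewrite dS; have -> : p ^+ n = p ^+ (n - k) * p ^+ k by rewrite -exprD subnK // ltnW.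
by ring.
Qed.

End QBinomial.

Section TripleProduct.
Variable K : fieldType.
Variable p : K.
Hypothesis p_unity : forall n, 1 - p ^+ n.+1 != 0.
Hypothesis p_neq0 : p != 0.

(** The terms of the Laurent series of theta: the sign (-1)^t is absorbed in
    the power of -z. *)
Definition theta_term (z : K) (t : int) : K := p ^ triangle t * (- z) ^ t.

Lemma theta_term0 z : theta_term z 0 = 1.
Proof. by rewrite /theta_term mulr1. Qed.

Lemma theta_termS z t : z != 0 -> theta_term z (t + 1) = - z * p ^ t * theta_term z t.
Proof.
move=> z0; rewrite /theta_term.
have -> : triangle (t + 1) = triangle t + t.
  have := triangleE t; have := triangleE (t + 1); lia.
by rewrite !expfzDr ?oppr_eq0 // expr1z; ring.
Qed.

Lemma theta_term_mul (x y : K) (s t E F : int) : x != 0 -> y != 0 ->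
  triangle s + triangle t = E + F ->
  theta_term (x * y) s * theta_term (x / y) t =
  p ^ E * p ^ F * ((- x) ^ (s + t) * y ^ (s - t)).
Proof.
move=> x0 y0 hE; rewrite /theta_term -expfzDr // -hE !expfzDr ?oppr_eq0 //.
rewrite -(exprz_inv y t) -(mulNr x y) -(mulNr x) !expfzMl; ring.
Qed.

(** The q-binomial theorem with 2m factors starting at z p^(-m): the first m
    factors, read backwards, are the factors 1 - p^(j+1)/z up to monomials. *)
Lemma finite_triple_product z m : z != 0 ->
  \prod_(0 <= j < m) ((1 - z * p ^+ j) * (1 - p ^+ j.+1 / z)) =
  \sum_(0 <= k < (2 * m).+1) qbinom p (2 * m) k * theta_term z (k%:Z - m%:Z).
Proof.
move=> z0; pose w := z / p ^+ m.
have pm0 : p ^+ m != 0 by rewrite expf_neq0.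
have w0 : w != 0 by rewrite mulf_neq0 ?invr_eq0.
pose d k := \prod_(0 <= j < k) (- w * p ^+ j).
have dE k : d k * theta_term z (- m%:Z) = theta_term z (k%:Z - m%:Z).
  elim: k => [|k IH]; first by rewrite /d big_geq // mul1r sub0r.
  rewrite /d big_nat_recr //= -/(d k) mulrAC IH.
  rewrite (_ : k.+1%:Z - m%:Z = k%:Z - m%:Z + 1); last by lia.
  rewrite theta_termS // expfzDr // -exprz_inv -!exprnP exprVn /w; ring.
have dm : d m * theta_term z (- m%:Z) = 1.
  by rewrite dE subrr theta_term0.
have d0 : d 0 = 1 by rewrite /d big_geq.
have dS k : d k.+1 = - w * p ^+ k * d k by rewrite /d big_nat_recr //= mulrC.
have H := cauchy_binomial p_unity (2 * m) d0 dS.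
have factored : \prod_(0 <= j < m) ((1 - z * p ^+ j) * (1 - p ^+ j.+1 / z)) * d m =
  \prod_(0 <= j < 2 * m) (1 - w * p ^+ j).
  rewrite (@big_cat_nat _ _ _ m 0 (2 * m)) //=; last by lia.
  rewrite big_split /= -mulrA mulrC; congr (_ * _).
    rewrite [X in X * _]big_nat_rev /= -big_split /=; apply: eq_big_nat => j /andP[_ jm].
    rewrite add0n /w; have -> : (m - j.+1).+1 = (m - j)%N by lia.
    have -> : p ^+ m = p ^+ (m - j) * p ^+ j by rewrite -exprD subnK // ltnW.
    by field; rewrite !expf_neq0.
  rewrite -{2}[m]add0n big_addn (_ : 2 * m - m = m)%N; last by lia.
  by apply: eq_bigr => j _; rewrite exprD /w; field; rewrite expf_neq0.
have ins (X : K) : X = X * d m * theta_term z (- m%:Z) by rewrite -mulrA dm mulr1.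
rewrite [LHS]ins factored H mulr_suml; apply: eq_big_nat => k _.
by rewrite -mulrA dE.
Qed.

End TripleProduct.

(** * Theta as a Laurent series *)

Section ThetaSeries.
Local Open Scope classical_set_scope.
Variable R : realType.
Local Notation C := (complexField R).
Local Notation cmod := (@cmod R).
Variable p : C.
Hypothesis p_lt1 : cmod p < 1.
Hypothesis p_neq0 : p != 0.

Let r := cmod p.
Let r_gt0 : 0 < r. Proof. by rewrite /r cmod_gt0. Qed.
Let r_ge0 : 0 <= r. Proof. exact: ltW. Qed.
Let r01 : 0 <= r < 1. Proof. by rewrite /r cmod_ge0. Qed.

Lemma unity_free n : 1 - p ^+ n.+1 != 0.
Proof.
rewrite subr_eq0 eq_sym; apply/eqP => h.
have := p_lt1; rewrite -[X in _ < X](@cmod1 R) -h cmodX ltNge => /negP; apply.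
by rewrite exprS ler_piMr ?cmod_ge0 // exprn_ile1 ?cmod_ge0 // ltW.
Qed.

(** Eventually |u n| exceeds |l|/2, and the terms before are finitely many. *)
Lemma lower_bound_of_cvg (u : nat -> C) (l : C) : u @ \oo --> l -> l != 0 ->
  (forall n, u n != 0) -> exists2 e, 0 < e & forall n, e <= cmod (u n).
Proof.
move=> ul l0 u0; have cl : 0 < cmod l by rewrite cmod_gt0.
have hfin N : exists2 e, 0 < e & forall n, (n < N)%N -> e <= cmod (u n).
  elim: N => [|N [e e0 he]]; first by exists 1.
  exists (Num.min e (cmod (u N))); first by rewrite lt_min e0 cmod_gt0 u0.
  move=> n; rewrite ltnS leq_eqVlt => /orP[/eqP ->|nN]; first by rewrite ge_min lexx orbT.
  by rewrite ge_min he.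
have /cvg_cmodP/cvgrPdist_le /(_ (cmod l / 2)) := ul.
rewrite divr_gt0 // => /(_ isT) [N _ hN].
have [e e0 he] := hfin N.
exists (Num.min e (cmod l / 2)); first by rewrite lt_min e0 divr_gt0.
move=> n; have [nN|Nn] := ltnP n N; first by rewrite ge_min he.
rewrite ge_min; apply/orP; right; have := hN n Nn.
rewrite /= sub0r normrN ger0_norm ?cmod_ge0 // => h.
by have := le_cmodD (l - u n) (u n); rewrite subrK; lra.
Qed.

(** The q-binomial Q(m) / (Q(i) Q(m-i)) tends to 1/P when i and m - i grow, P
    being the limit of the Euler products Q; the error is governed by the
    distances of Q(i) and Q(m-i) to their limits. *)
Lemma qbinom_limit : exists P, P != 0 /\ exists2 K, 0 <= K &
  forall m i, (i <= m)%N -> cmod (1 - P * qbinom p m i) <= K * (r ^+ i + r ^+ (m - i)).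
Proof.
pose f j := 1 - p ^+ j.+1.
have hf j : cmod (f j - 1) <= 1 * r ^+ j.
  rewrite /f addrAC subrr sub0r cmodN cmodX mul1r; apply: ler_wiXn2l => //.
  exact: ltW.
have [P hP] := prod_geometric_cvg ler01 r01 hf.
have P0 := prod_geometric_neq0 ler01 r01 hf unity_free hP.
have [e e0 he] := lower_bound_of_cvg hP P0 (fun n => euler_neq0 unity_free n).
pose T := 1 / (1 - r) * expR (1 / (1 - r)).
have T0 : 0 <= T.
  by rewrite mulr_ge0 ?expR_ge0 // divr_ge0 // subr_ge0 ltW //; case/andP: r01.
have tail m n : (m <= n)%N -> cmod (euler p n - euler p m) <= T * r ^+ m.
  by move=> mn; exact: prod_geometric_tail.
have tailP m : cmod (euler p m - P) <= T * r ^+ m.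
  rewrite cmodB -(cmodN (P - _)) opprB.
  pose v n := euler p (n + m)%N.
  have hv : v @ \oo --> P by move: hP; rewrite -(cvg_shiftn m).
  by apply: cvg_cmod_bound hv _ => n; rewrite cmodB; apply: tail; exact: leq_addl.
have up m : cmod (euler p m) <= 1 + T.
  have := tail 0 m (leq0n m); rewrite expr0 mulr1 euler0 => h.
  by have := le_cmodD (euler p m - 1) 1; rewrite subrK cmod1; lra.
have t0 : 0 <= 1 + T by rewrite addr_ge0.
have ee : 0 < e * e by rewrite mulr_gt0.
exists P; split=> //; exists ((1 + T) * T / (e * e)).
  by apply: divr_ge0 (ltW ee); rewrite mulr_ge0.
move=> m i im; rewrite /qbinom.
have n1 := euler_neq0 unity_free i; have n2 := euler_neq0 unity_free (m - i).
have -> : 1 - P * (euler p m / (euler p i * euler p (m - i))) =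
  (euler p m * (euler p i - P) - euler p i * (euler p m - euler p (m - i))) /
  (euler p i * euler p (m - i)) by field; rewrite n1 n2.
rewrite cmodM cmodV cmodM mulrAC; apply: ler_pM; rewrite ?invr_ge0 ?mulr_ge0 ?cmod_ge0 //.
  apply: le_trans (le_cmodD _ _) _; rewrite cmodN !cmodM.
  have -> : (1 + T) * T * (r ^+ i + r ^+ (m - i)) =
     (1 + T) * (T * r ^+ i) + (1 + T) * (T * r ^+ (m - i)) by ring.
  apply: lerD; apply: ler_pM; rewrite ?cmod_ge0 //.
  by apply: tail; exact: leq_subr.
rewrite lef_pV2 ?posrE ?mulr_gt0 ?cmod_gt0 //.
by apply: ler_pM; rewrite ?(ltW e0) ?he.
Qed.

Definition zsum (f : int -> C) (m : nat) : C := \sum_(k <- zrange m) f k.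

Lemma cvg_of_sub0 (u v : nat -> C) (l : C) :
  (fun n => u n - v n) @ \oo --> (0 : C) -> u @ \oo --> l -> v @ \oo --> l.
Proof.
move=> uv ul; have := cvg_seqB ul uv; rewrite subr0.
by have -> : (fun n => u n - (u n - v n)) = v by apply/funext => n; rewrite opprB addrC subrK.
Qed.

Lemma theta_term_bound (z : C) : z != 0 ->
  exists2 B, 0 <= B & forall t, cmod (theta_term p z t) <= B * r ^+ absz t.
Proof.
move=> z0; apply: gaussian_bound => //; first by rewrite oppr_eq0.
by move=> t; have := triangleE t; nia.
Qed.

(** Compare the finite triple product with the series term by term: the factor
    r^|t| of the Gaussian bound compensates the loss r^(-|t|) in the rate of
    convergence of the q-binomials, and 2m + 1 errors O(r^m) tend to 0. *)
Lemma theta_series : exists P, P != 0 /\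
  forall z : C, z != 0 -> zsum (theta_term p z) @ \oo --> P * theta p z.
Proof.
have [P [P0 [K K0 hK]]] := qbinom_limit.
exists P; split=> // z z0; have [B B0 hB] := theta_term_bound z0.
apply: (@cvg_of_sub0 (fun m => P * theta_partial p z m)); last first.
  by apply: cvg_seqM; [exact: cvg_seq_cst|exact: theta_cvg].
apply: (@cvg_cmod_le _ _ _ (fun m => ((2 * m).+1%:R) ^+ 2 * (2 * K * B * r ^+ m))); last first.
  by apply: cvg_square_geometric; rewrite ?r_gt0 // !mulr_ge0.
move=> m; rewrite sub0r opprB /theta_partial.
have -> : \prod_(0 <= j < m) theta_factor p z j =
   \sum_(0 <= k < (2 * m).+1) qbinom p (2 * m) k * theta_term p z (k%:Z - m%:Z).
  by apply: finite_triple_product => //; exact: unity_free.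
rewrite /zsum /zrange big_map /index_iota subn0 mulr_sumr -sumrB.
apply: le_trans (cmod_sum _ _ _) _.
apply: (@le_trans _ _ ((size (iota 0 (2 * m).+1))%:R * (2 * K * B * r ^+ m))); last first.
  rewrite size_iota; apply: ler_wpM2r; first by rewrite !mulr_ge0 ?exprn_ge0.
  by rewrite -natrX ler_nat expnS leq_pmulr // expn_gt0.
apply: ler_sum_size_seq => i; rewrite mem_iota add0n ltnS => /andP[_ im].
have -> : theta_term p z (i%:Z - m%:Z) - P * (qbinom p (2 * m) i * theta_term p z (i%:Z - m%:Z))
  = (1 - P * qbinom p (2 * m) i) * theta_term p z (i%:Z - m%:Z) by ring.
rewrite cmodM; apply: le_trans (ler_pM _ _ (hK _ _ im) (hB _)) _; rewrite ?cmod_ge0 //.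
set t := absz _.
rewrite [leLHS](_ : _ = K * B * (r ^+ i * r ^+ t + r ^+ (2 * m - i) * r ^+ t)); last by ring.
rewrite [leRHS](_ : _ = K * B * (r ^+ m + r ^+ m)); last by ring.
apply: ler_wpM2l; first by rewrite mulr_ge0.
by rewrite -!exprD; apply: lerD; apply: ler_wiXn2l; rewrite ?r_ge0 ?(ltW p_lt1) //; lia.
Qed.

End ThetaSeries.

(** * The rank two property *)

Section ParitySplitting.

Definition zbox (m : nat) : seq (int * int) :=
  [seq (u, v) | u <- zrange m, v <- zrange m].

Definition even_pair (w : int * int) : int * int := (w.1 + w.2, w.1 - w.2).
Definition odd_pair (w : int * int) : int * int := (w.1 + w.2 + 1, w.1 - w.2).

Lemma mem_zbox m w : (w \in zbox m) = (absz w.1 <= m)%N && (absz w.2 <= m)%N.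
Proof.
case: w => u v; rewrite -!mem_zrange /zbox.
apply/idP/idP => [/allpairsP[[a b]] /= [ha hb [-> ->]]|/andP[hu hv]].
  by rewrite ha hb.
by apply/allpairsP; exists (u, v).
Qed.

Lemma zbox_uniq m : uniq (zbox m).
Proof. by apply: allpairs_uniq; rewrite ?zrange_uniq // => -[a b] [c d]. Qed.

Lemma size_zbox m : size (zbox m) = ((2 * m).+1 ^ 2)%N.
Proof. by rewrite size_allpairs size_zrange. Qed.

(** Change of variables by parity of k + l.  The images of the square under the
    two substitutions overflow it, whence the filters. *)
Lemma zbox_parity m : perm_eq (zbox m)
  ([seq even_pair w | w <- zbox m & even_pair w \in zbox m] ++
   [seq odd_pair w | w <- zbox m & odd_pair w \in zbox m]).
Proof.
have ie : injective even_pair by move=> [a b] [c d] [] h1 h2; congr (_, _); lia.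
have io : injective odd_pair by move=> [a b] [c d] [] h1 h2; congr (_, _); lia.
move: (zbox m) (mem_zbox m) (zbox_uniq m) => Z hZ uZ.
apply: uniq_perm; first exact: uZ.
  rewrite cat_uniq !map_inj_uniq // !filter_uniq ?uZ // andbT /=.
  apply/hasPn => _ /mapP[[a b] _ ->]; apply/mapP => -[[c d] _ []] h1 h2; lia.
move=> w; rewrite mem_cat; apply/idP/idP; last first.
  by case/orP=> /mapP[v]; rewrite mem_filter => /andP[hv _] ->.
case: w => k l hkl; have := hkl; rewrite hZ /= => /andP[hk hl].
pose u := ((k + l) %/ 2)%Z.
have [h|h] : k + l = 2 * u \/ k + l = 2 * u + 1 by rewrite /u; lia.
  apply/orP; left; apply/mapP; exists (u, k - u);
    last by rewrite /even_pair /fst /snd; congr (_, _); lia.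
  rewrite mem_filter !hZ /even_pair /fst /snd; lia.
apply/orP; right; apply/mapP; exists (u, u - l);
  last by rewrite /odd_pair /fst /snd; congr (_, _); lia.
rewrite mem_filter !hZ /odd_pair /fst /snd; lia.
Qed.

Lemma zbox_sum_parity (V : zmodType) (F : int * int -> V) m :
  \sum_(w <- zbox m) F w =
  \sum_(w <- zbox m) F (even_pair w) + \sum_(w <- zbox m) F (odd_pair w) -
  (\sum_(w <- zbox m | even_pair w \notin zbox m) F (even_pair w) +
   \sum_(w <- zbox m | odd_pair w \notin zbox m) F (odd_pair w)).
Proof.
rewrite [LHS](perm_big _ (zbox_parity m)) big_cat !big_map !big_filter /=.
rewrite (bigID (fun w => even_pair w \in zbox m) predT) /=.
rewrite [in X in _ = _ + X - _](bigID (fun w => odd_pair w \in zbox m) predT) /=.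
by rewrite addrACA addrK.
Qed.

End ParitySplitting.

Section RankTwo.
Local Open Scope classical_set_scope.
Variable R : realType.
Local Notation C := (complexField R).
Local Notation cmod := (@cmod R).

Lemma zsum_mul (f g : int -> C) m :
  zsum f m * zsum g m = \sum_(w <- zbox m) f w.1 * g w.2.
Proof.
rewrite /zsum big_distrl /= /zbox big_allpairs; apply: eq_bigr => u _.
by rewrite big_distrr.
Qed.

(** The square of pairs (k, l) with |k|, |l| <= m and its two parity classes,
    cut at |u|, |v| <= m, differ only by pairs outside the square of size m,
    whose terms are O(r^m) and O(m^2) in number. *)
Lemma cvg_parity (r : R) (f g : int -> C) (B D : R) : 0 < r < 1 -> 0 <= B -> 0 <= D ->
  (forall t, cmod (f t) <= B * r ^+ absz t) ->
  (forall t, cmod (g t) <= D * r ^+ absz t) ->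
  (fun m => zsum f m * zsum g m -
     (\sum_(w <- zbox m) f (w.1 + w.2) * g (w.1 - w.2) +
      \sum_(w <- zbox m) f (w.1 + w.2 + 1) * g (w.1 - w.2))) @ \oo --> (0 : C).
Proof.
move=> r01 B0 D0 hf hg; have /andP[r0 r1] := r01.
have out m w : w \notin zbox m -> cmod (f w.1 * g w.2) <= B * D * r ^+ m.
  rewrite mem_zbox => hw; rewrite cmodM.
  apply: le_trans (ler_pM _ _ (hf _) (hg _)) _; rewrite ?cmod_ge0 //.
  rewrite mulrACA -exprD; apply: ler_wpM2l; first exact: mulr_ge0.
  by apply: ler_wiXn2l; rewrite ?(ltW r0) ?(ltW r1) //; lia.
have K0 m : 0 <= B * D * r ^+ m by rewrite !mulr_ge0 ?exprn_ge0 // ltW.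
apply: (@cvg_cmod_le _ _ _ (fun m => ((2 * m).+1%:R) ^+ 2 * (2 * B * D * r ^+ m))); last first.
  by apply: cvg_square_geometric => //; rewrite !mulr_ge0.
move=> m; rewrite sub0r cmodN zsum_mul.
rewrite (zbox_sum_parity (fun w => f w.1 * g w.2)) /=.
rewrite [X in cmod X]addrAC subrr add0r cmodN.
apply: le_trans (le_cmodD _ _) _.
rewrite [leRHS](_ : _ = (size (zbox m))%:R * (B * D * r ^+ m) +
    (size (zbox m))%:R * (B * D * r ^+ m)).
  apply: lerD; apply: le_trans (cmod_sum _ _ _) _; apply: ler_sum_size => // w hw.
    exact: (out _ (even_pair w)).
  exact: (out _ (odd_pair w)).
by rewrite size_zbox natrX; ring.
Qed.

Variable p : C.
Hypothesis p_lt1 : cmod p < 1.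

Lemma cvg_zsum (r : R) (f : int -> C) (B : R) : 0 < r < 1 -> 0 <= B ->
  (forall t, cmod (f t) <= B * r ^+ absz t) -> exists l : C, zsum f @ \oo --> l.
Proof.
move=> r01 B0 hf; have /andP[r0 r1] := r01.
have r01' : 0 <= r < 1 by rewrite ltW.
have zsumS m : zsum f m.+1 = zsum f m + (f (m.+1%:Z) + f (- m.+1%:Z)).
  have hp : perm_eq (zrange m.+1) (m.+1%:Z :: - m.+1%:Z :: zrange m).
    apply: uniq_perm; first exact: zrange_uniq.
      by rewrite cons_uniq cons_uniq zrange_uniq in_cons !mem_zrange; lia.
    by move=> k; rewrite [RHS]in_cons [X in _ || X]in_cons !mem_zrange; lia.
  by rewrite /zsum (perm_big _ hp); move: (zrange m) => Z; rewrite !big_cons /= addrA addrC.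
apply: (@cvg_of_cauchy _ _ (fun m => (2 * B / (1 - r)) * r ^+ m)).
  exact: cvg_geometric0.
move=> m n mn.
have -> : zsum f n - zsum f m = \sum_(m <= j < n) (f (j.+1%:Z) + f (- j.+1%:Z)).
  elim: n mn => [|n IH]; first by rewrite leqn0 => /eqP ->; rewrite subrr big_geq.
  rewrite leq_eqVlt => /orP[/eqP <-|mn]; first by rewrite subrr big_geq.
  by rewrite big_nat_recr //= zsumS -IH // addrAC.
apply: le_trans (cmod_sum _ _ _) _.
apply: (@le_trans _ _ (\sum_(m <= j < n) 2 * B * r ^+ j)).
  apply: ler_sum => j _; apply: le_trans (le_cmodD _ _) _.
  have h : B * r ^+ j.+1 <= B * r ^+ j.
    by apply: ler_wpM2l => //; apply: ler_wiXn2l; rewrite ?(ltW r0) ?(ltW r1).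
  have := hf (j.+1%:Z); have := hf (- j.+1%:Z); rewrite abszN /=; lra.
rewrite -mulr_sumr -mulrA mulrAC -!mulrA; do 2 apply: ler_wpM2l => //.
exact: geometric_sum_le.
Qed.

(** For p = 0 theta is 1 - z and the decomposition is explicit.  Otherwise the
    exponents of p in the product of the two series are u^2 - u + v^2 on the
    even class and u^2 + v^2 + v on the odd one, with monomials x^(2u) y^(2v)
    and -x^(2u+1) y^(2v+1): each class is a product of two series. *)
Lemma theta_rank_two : exists (al be A B : C -> C), forall x y, x != 0 -> y != 0 ->
  theta p (x * y) * theta p (x / y) = al x * A y + be x * B y.
Proof.
(* Exponents of p are recombined in the integers, so p = 0 is treated apart. *)
have [p0|p0] := eqVneq p 0.
  have E a : theta p a = 1 - a.
    apply: cvg_uniq (@theta_cvg R p p_lt1 a) _.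
    apply/cvg_cmodP/cvgrPdist_le => e e0; exists 1%N => // m /= m1.
    rewrite /theta_partial big_ltn // big_nat_cond big1 => [|j /andP[/andP[j0 _] _]].
      by rewrite /theta_factor p0 !expr0n /= mul0r !(subr0, mulr1) subrr cmod0 subrr normr0 ltW.
    by rewrite /theta_factor p0 !expr0n /= gtn_eqF // mulr0 mul0r !subr0 mulr1.
  exists (fun x => 1 + x ^+ 2), (fun x => - x), (fun=> 1), (fun y => y + y^-1) => x y x0 y0.
  by rewrite !E; field.
have [P [P0 hP]] := theta_series p_lt1 p0.
have r01 : 0 < cmod p < 1 by rewrite cmod_gt0 p0.
have lim (E : int -> int) : (forall t, t * t - 3 * (absz t)%:Z <= 2 * E t) ->
    exists F : C -> C, forall w, w != 0 -> zsum (fun t => p ^ E t * w ^ t) @ \oo --> (F w : C).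
  move=> hE; pose Q (w l : C) := w != 0 -> zsum (fun t => p ^ E t * w ^ t) @ \oo --> l.
  have hQ (w : C) : exists l : C, Q w l.
    have [w0|w0] := eqVneq w 0; first by exists 0; rewrite /Q w0 eqxx.
    have [B B0 hB] := gaussian_bound p_lt1 p0 w0 hE.
    by have [l hl] := cvg_zsum r01 B0 hB; exists l => _.
  by have [F hF] := choice hQ; exists F.
have [A hA] := lim (fun t => t * t) ltac:(move=> t; nia).
have [A' hA'] := lim (fun t => t * t - t) ltac:(move=> t; nia).
have [B hB] := lim (fun t => t * t + t) ltac:(move=> t; nia).
exists (fun x => A' (x ^+ 2) / P ^+ 2), (fun x => - (x * A (x ^+ 2)) / P ^+ 2),
  (fun y => A (y ^+ 2)), (fun y => y * B (y ^+ 2)) => x y x0 y0.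
have separate := theta_term_mul p0 x0 y0.
have even_pow (w : C) (e : int) : w ^ (2 * e) = (w ^+ 2) ^ e by rewrite -exprz_exp -exprnP.
have xy0 : x * y != 0 by rewrite mulf_neq0.
have xdy0 : x / y != 0 by rewrite mulf_neq0 ?invr_eq0.
have x20 : x ^+ 2 != 0 by rewrite expf_neq0.
have y20 : y ^+ 2 != 0 by rewrite expf_neq0.
have [D1 D10 hD1] := theta_term_bound p_lt1 p0 xy0.
have [D2 D20 hD2] := theta_term_bound p_lt1 p0 xdy0.
have h := cvg_parity r01 D10 D20 hD1 hD2.
have h2 := cvg_of_sub0 h (cvg_seqM (hP _ xy0) (hP _ xdy0)).
have h3 := cvg_seqD (cvg_seqM (hA' _ x20) (hA _ y20))
  (cvg_seqM (@cvg_seq_cst C (- (x * y))) (cvg_seqM (hA _ x20) (hB _ y20))).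
have E : P * theta p (x * y) * (P * theta p (x / y)) =
  A' (x ^+ 2) * A (y ^+ 2) + - (x * y) * (A (x ^+ 2) * B (y ^+ 2)).
  apply: cvg_uniq h2 _.
  have -> // : (fun n =>
     \sum_(w <- zbox n) theta_term p (x * y) (w.1 + w.2) * theta_term p (x / y) (w.1 - w.2) +
     \sum_(w <- zbox n) theta_term p (x * y) (w.1 + w.2 + 1) * theta_term p (x / y) (w.1 - w.2))
   = (fun n => zsum (fun t => p ^ (t * t - t) * (x ^+ 2) ^ t) n *
       zsum (fun t => p ^ (t * t) * (y ^+ 2) ^ t) n +
     - (x * y) * (zsum (fun t => p ^ (t * t) * (x ^+ 2) ^ t) n *
       zsum (fun t => p ^ (t * t + t) * (y ^+ 2) ^ t) n)).
  apply/funext => n; rewrite !zsum_mul mulr_sumr; congr (_ + _).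
    apply: eq_bigr => -[u v] _ /=.
    rewrite (separate _ _ (u * u - u) (v * v)); last first.
      by apply: (@mulIf _ (2 : int)) => //; rewrite mulrDl !triangleE; ring.
    rewrite (_ : u + v + (u - v) = 2 * u); last by ring.
    rewrite (_ : u + v - (u - v) = 2 * v); last by ring.
    by rewrite !even_pow sqrrN; ring.
  apply: eq_bigr => -[u v] _ /=.
  rewrite (separate _ _ (u * u) (v * v + v)); last first.
    by apply: (@mulIf _ (2 : int)) => //; rewrite mulrDl !triangleE; ring.
  rewrite (_ : u + v + 1 + (u - v) = 2 * u + 1); last by ring.
  rewrite (_ : u + v + 1 - (u - v) = 2 * v + 1); last by ring.
  by rewrite !expfzDr ?oppr_eq0 // !even_pow sqrrN !expr1z; ring.
have PP : P ^+ 2 != 0 by rewrite expf_neq0.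
apply: (mulfI PP); rewrite mulrDr !mulrA.
rewrite (_ : P ^+ 2 * theta p (x * y) * theta p (x / y) =
  P * theta p (x * y) * (P * theta p (x / y))); last by ring.
by rewrite E; field.
Qed.
End RankTwo.

(** * Binary forms *)

Section BinaryForms.
Variables (K : fieldType) (A B : K -> K).

(** Homogeneous polynomials of degree M in A and B, represented by their
    dehomogenization P.  Where B vanishes only the leading coefficient counts,
    so the second clause records the value at the point at infinity. *)
Definition form (M : nat) (f : K -> K) : Prop :=
  exists2 P : {poly K}, (size P <= M.+1)%N & forall c, c != 0 ->
    (B c != 0 -> f c = B c ^+ M * P.[A c / B c]) /\
    (B c = 0 -> f c = P`_M * A c ^+ M).

Lemma eq_form M f g : (forall c, c != 0 -> f c = g c) -> form M f -> form M g.
Proof. by move=> fg [P sP hP]; exists P => // c c0; rewrite -fg //; exact: hP. Qed.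

Lemma form_cst a : form 0 (fun=> a).
Proof.
exists a%:P; first by rewrite size_polyC; case: (a != 0).
by move=> c _; rewrite !expr0 hornerC coefC mul1r mulr1.
Qed.

Lemma form_linear a b : form 1 (fun c => a * A c + b * B c).
Proof.
exists (a *: 'X + b%:P).
  apply: leq_trans (size_polyD _ _) _; rewrite geq_max size_polyC.
  rewrite (leq_trans (size_scale_leq _ _)) ?size_polyX //.
  by case: (b != 0).
move=> c _; rewrite !expr1; split=> [Bc|->].
  by rewrite hornerD hornerZ hornerX hornerC; field.
by rewrite mulr0 addr0 coefD coefZ coefX coefC mulr1 addr0.
Qed.

Lemma formD M f g : form M f -> form M g -> form M (fun c => f c + g c).
Proof.
move=> [P sP hP] [Q sQ hQ]; exists (P + Q).
  by apply: leq_trans (size_polyD _ _) _; rewrite geq_max sP.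
move=> c c0; have [hP1 hP2] := hP c c0; have [hQ1 hQ2] := hQ c c0.
split=> Bc; first by rewrite hornerD mulrDr hP1 // hQ1.
by rewrite coefD mulrDl hP2 // hQ2.
Qed.

(** This is what makes the value at infinity multiplicative. *)
Lemma coefM_top (P Q : {poly K}) M N : (size P <= M.+1)%N -> (size Q <= N.+1)%N ->
  (P * Q)`_(M + N) = P`_M * Q`_N.
Proof.
move=> sP sQ; have hM : (M < (M + N).+1)%N by rewrite ltnS leq_addr.
rewrite coefM (bigD1 (Ordinal hM)) //= addKn big1 ?addr0 // => i.
rewrite -val_eqE /= => iM; have [lt|ge] := ltnP M i.
  by rewrite [P`_i]nth_default ?mul0r // (leq_trans sP).
rewrite [Q`__]nth_default ?mulr0 // (leq_trans sQ) //.
have := ltn_neqAle i M; rewrite iM ge /= => lt; lia.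
Qed.

Lemma formM M N f g : form M f -> form N g -> form (M + N) (fun c => f c * g c).
Proof.
move=> [P sP hP] [Q sQ hQ]; exists (P * Q).
  apply: leq_trans (size_polyMleq _ _) _; rewrite -ltnS.
  by case: (size P + size Q)%N (leq_add sP sQ) => //=; rewrite addSn addnS => n; lia.
move=> c c0; have [hP1 hP2] := hP c c0; have [hQ1 hQ2] := hQ c c0.
split=> Bc; first by rewrite hornerM exprD hP1 // hQ1 // mulrACA.
by rewrite coefM_top // exprD hP2 // hQ2 // mulrACA.
Qed.

Lemma formZ M a f : form M f -> form M (fun c => a * f c).
Proof. by move=> hf; have := formM (form_cst a) hf. Qed.

Lemma form0 M : form M (fun=> 0).
Proof.
exists 0; rewrite ?size_poly0 // => c _.
by rewrite horner0 coef0 mulr0 mul0r.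
Qed.

Lemma form_sum (I : Type) (s : seq I) (P : pred I) M (f : I -> K -> K) :
  (forall i, P i -> form M (f i)) -> form M (fun c => \sum_(i <- s | P i) f i c).
Proof.
move=> h; elim: s => [|i s IH].
  by apply: eq_form (form0 M) => c _; rewrite big_nil.
case Pi: (P i).
  by apply: eq_form (formD (h _ Pi) IH) => c _; rewrite big_cons Pi.
by apply: eq_form IH => c _; rewrite big_cons Pi.
Qed.

Lemma form_prod (I : Type) (s : seq I) (P : pred I) (f : I -> K -> K) :
  (forall i, P i -> form 1 (f i)) ->
  form (count P s) (fun c => \prod_(i <- s | P i) f i c).
Proof.
move=> h; elim: s => [|i s IH] /=.
  by apply: eq_form (form_cst 1) => c _; rewrite big_nil.
case Pi: (P i).
  by apply: eq_form (formM (h _ Pi) IH) => c _; rewrite big_cons Pi.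
by apply: eq_form IH => c _; rewrite big_cons Pi.
Qed.

Definition independent (s : seq K) :=
  {in s &, forall c d, c != d -> A c * B d != A d * B c}.

(** P has the root A c / B c for each point c with B c != 0.  At most one point
    has B c = 0; then P has degree less than M, and one root less suffices. *)
Lemma form_eq0 M f (s : seq K) : form M f -> size s = M.+1 -> uniq s ->
  independent s -> (forall c, c \in s -> c != 0 /\ f c = 0) ->
  forall c, c != 0 -> f c = 0.
Proof.
move=> [P sP hP] sM us indep fs.
have roots (t : seq K) : uniq t -> {subset t <= s} ->
    (forall c, c \in t -> B c != 0) -> (size P <= size t)%N -> P = 0.
  move=> ut ts Bt sPt; apply: (@roots_geq_poly_eq0 _ _ [seq A c / B c | c <- t]).
  - apply/allP => _ /mapP[c ct ->]; have [c0 fc] := fs c (ts _ ct).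
    have := (hP c c0).1 (Bt _ ct); rewrite fc => /esym/eqP.
    by rewrite mulf_eq0 expf_eq0 (negbTE (Bt _ ct)) andbF.
  - rewrite map_inj_in_uniq // => c d ct dt /eqP; rewrite eqr_div ?Bt // => e.
    by apply/eqP; apply: contraTT e; apply: indep; exact: ts.
  - by rewrite size_map.
suff P0 : P = 0.
  move=> c c0; have [h1 h2] := hP c c0.
  by have [Bc|Bc] := eqVneq (B c) 0; [rewrite h2 // P0 coef0 mul0r|rewrite h1 // P0 horner0 mulr0].
have [/hasP[c cs /eqP Bc]|/hasPn hB] := boolP (has (fun c => B c == 0) s); last first.
  by apply: (roots s) => //; rewrite sM.
have [c0 fc] := fs c cs.
have sr : size (rem c s) = M by rewrite size_rem // sM.
have rems d : d \in rem c s -> d \in s /\ A c * B d != 0.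
  rewrite mem_rem_uniq // inE => /andP[dc ds]; split=> //.
  have := indep c d cs ds; rewrite eq_sym dc Bc mulr0; exact.
have PM : P`_M = 0.
  have := (hP c c0).2 Bc; rewrite fc => /esym/eqP; rewrite mulf_eq0 => /orP[/eqP //|].
  rewrite expf_eq0 => /andP[M0 /eqP Ac]; move: sr M0.
  case: (rem c s) rems => [|d r] rems; first by move=> <-.
  by have [|_] := rems d; rewrite ?mem_head // Ac mul0r eqxx.
apply: (roots (rem c s)) => //.
- by rewrite rem_uniq.
- by move=> d /rems[].
- by move=> d /rems[_]; rewrite mulf_eq0 negb_or => /andP[].
- rewrite sr leqNgt; apply/negP => lt.
  have sPM : size P = M.+1 by apply/eqP; rewrite eqn_leq sP.
  have : lead_coef P == 0 by rewrite lead_coefE sPM PM.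
  by rewrite lead_coef_eq0 => /eqP P0; move: sPM; rewrite P0 size_poly0.
Qed.

End BinaryForms.

(** * The subset identity for generic b *)

Section PairProducts.
Variables (K : comNzRingType) (T : finType).

(** Product over unordered pairs, when w is symmetric; the enumeration of T
    serves only to list each pair once. *)
Definition pair_prod (I : {set T}) (w : T -> T -> K) : K :=
  \prod_(i in I) \prod_(j in I | (enum_rank i < enum_rank j)%N) w i j.

Lemma pair_prodU1 (I : {set T}) t (w : T -> T -> K) : t \notin I ->
  (forall i j, w i j = w j i) ->
  pair_prod (t |: I) w = pair_prod I w * \prod_(j in I) w t j.
Proof.
move=> tI wC; rewrite /pair_prod big_setU1 //=.
have -> : \prod_(j in t |: I | (enum_rank t < enum_rank j)%N) w t j =
    \prod_(j in I) (if (enum_rank t < enum_rank j)%N then w t j else 1).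
  rewrite big_mkcondr big_setU1 //= ltnn mul1r; exact: eq_bigr.
have -> : \prod_(i in I) \prod_(j in t |: I | (enum_rank i < enum_rank j)%N) w i j =
    \prod_(i in I) \prod_(j in I | (enum_rank i < enum_rank j)%N) w i j *
    \prod_(i in I) (if (enum_rank i < enum_rank t)%N then w t i else 1).
  rewrite -big_split /=; apply: eq_bigr => i iI.
  rewrite big_mkcondr big_setU1 //= -big_mkcondr mulrC; congr (_ * _).
  by rewrite wC.
rewrite mulrCA; congr (_ * _); rewrite -big_split /=; apply: eq_bigr => j jI.
have : enum_rank t != enum_rank j :> nat.
  by apply: contraNneq tI => /ord_inj/enum_rank_inj ->.
by case: ltngtP => //= _ _; rewrite ?mulr1 ?mul1r.
Qed.

End PairProducts.

Section SubsetIdentity.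
Variables (K : fieldType) (th : K -> K) (q : K) (T : finType) (y : T -> K) (a e : K).

Definition shifted (u : K) (n : nat) : K := \prod_(0 <= j < n) th (u * q ^+ j).

Definition pair_weight (i j : T) : K := th (q * e * y i * y j) / th (e * y i * y j).

(** With e = aq/d, y_t = x_r q^u and I the cells selected by j, this is the j-th
    summand of the Bailey sum, up to a factor independent of j.  The factors that
    depend on c form pairs theta(cu) theta(l^2 u/c) with l^2 = ae/b. *)
Definition subset_term (S : {set T}) (b c : K) (I : {set T}) : K :=
  shifted (b / a) (#|S| - #|I|) * (b / a) ^+ #|I| *
  (shifted (a * q ^+ #|I|.+1 / c) (#|S| - #|I|) *
   shifted (b * c * q ^+ #|I|.+1 / e) (#|S| - #|I|)) *
  \prod_(i in I) (th (c * y i) * th (a * e * y i / (b * c)) *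
     (th (a * q ^+ #|I| / (e * y i)) * th (b * q ^+ #|S| * y i) /
      (th (e * y i * y i) * th (a * q ^+ #|I| * y i)))) *
  \prod_(j in S :\: I) (th (a * q ^+ #|I|.+1 * y j))^-1 *
  \prod_(i in I) \prod_(j in S :\: I) (th (q * y j / y i) / th (y j / y i)) *
  pair_prod I pair_weight.

Definition subset_total (S : {set T}) (b c : K) : K :=
  pair_prod S pair_weight *
  \prod_(i in S) (th (b * q ^+ #|S| / (e * y i)) / th (e * y i * y i) *
    (th (b * c * y i / a) * th (e * y i / c))).

Hypothesis th1 : th 1 = 0.
Hypothesis thV : forall z, z != 0 -> th z^-1 = - z^-1 * th z.
Hypothesis q0 : q != 0.
Hypothesis a0 : a != 0.
Hypothesis e0 : e != 0.
Hypothesis y0 : forall i, y i != 0.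
Hypothesis thy : forall i j, i != j -> th (y j / y i) != 0.
Hypothesis they : forall i j, th (e * y i * y j) != 0.
Hypothesis thay : forall k i, th (a * q ^+ k * y i) != 0.

Lemma shiftedSl u n : shifted u n.+1 = th u * shifted (u * q) n.
Proof.
rewrite /shifted big_nat_recl // expr0 mulr1; congr (_ * _).
by apply: eq_bigr => j _; rewrite exprS mulrA.
Qed.

Lemma shiftedSr u n : shifted u n.+1 = shifted u n * th (u * q ^+ n).
Proof. by rewrite /shifted big_nat_recr. Qed.

Lemma pair_weightC i j : pair_weight i j = pair_weight j i.
Proof. by rewrite /pair_weight -!mulrA (mulrC (y i)). Qed.

Lemma theta_ratioV z : z != 0 -> th z != 0 -> th (q / z) / th z^-1 * th z = q * th (z / q).
Proof.
move=> z0 tz; have -> : q / z = (z / q)^-1 by rewrite invf_div.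
rewrite !thV ?mulf_neq0 ?invr_eq0 // invf_div; field.
by rewrite tz z0 oppr_eq0 oner_eq0.
Qed.

(** At c = 1/y_t the factor theta(a q^(|I|+1) y_t) of the remaining index t
    cancels, and theta(q y_t/y_i)/theta(y_t/y_i) turns theta(y_i/y_t) into
    q theta(y_i/(q y_t)), that is c into c/q. *)
Lemma subset_term_node (S : {set T}) t b (I : {set T}) : t \notin S -> b != 0 -> I \subset S ->
  subset_term (t |: S) b (y t)^-1 I =
  th (b / a) * th (b * q ^+ #|S|.+1 / (e * y t)) *
    subset_term S (b * q) ((y t)^-1 / q) I.
Proof.
move=> tS b0 IS; have tI : t \notin I by apply: contra tS => /(fintype.subsetP IS).
have IS' : (#|I| <= #|S|)%N by apply: subset_leq_card.
have yt0 := y0 t.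
have tD : t \notin S :\: I by rewrite !inE (negbTE tS) andbF.
have DE : (t |: S) :\: I = t |: (S :\: I).
  by apply/finset.setP => i; rewrite !inE; case: eqP => // ->; rewrite tI.
rewrite /subset_term cardsU1 tS add1n DE !big_setU1 //= subSn //.
set k := (#|S| - #|I|)%N.
rewrite shiftedSl [shifted (a * q ^+ #|I|.+1 / (y t)^-1) k.+1]shiftedSl
  [shifted (b * (y t)^-1 * q ^+ #|I|.+1 / e) k.+1]shiftedSr.
have -> : b / a * q = b * q / a by rewrite mulrAC.
have -> : a * q ^+ #|I|.+1 / (y t)^-1 = a * q ^+ #|I|.+1 * y t by rewrite invrK.
have -> : b / y t * q ^+ #|I|.+1 / e * q ^+ k = b * q ^+ #|S|.+1 / (e * y t).
  have -> : q ^+ #|S|.+1 = q ^+ #|I|.+1 * q ^+ k.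
    by rewrite -exprD; congr (_ ^+ _); rewrite /k; lia.
  by field; rewrite ?e0 ?yt0 ?q0 ?oner_neq0.
have -> : a * q ^+ #|I|.+1 / ((y t)^-1 / q) = a * q ^+ #|I|.+1 * y t * q.
  by field; rewrite ?e0 ?yt0 ?q0 ?oner_neq0.
have -> : b * q * ((y t)^-1 / q) = b / y t by field; rewrite ?e0 ?yt0 ?q0 ?oner_neq0.
have -> : (b * q / a) ^+ #|I| = (b / a) ^+ #|I| * q ^+ #|I|.
  by rewrite -exprMn mulrAC.
set X1 := shifted _ k; set X2 := shifted _ k; set X3 := shifted _ k.
have -> : \prod_(i in I) \prod_(j in t |: S :\: I) (th (q * y j / y i) / th (y j / y i)) =
  \prod_(i in I) (th (q * y t / y i) / th (y t / y i)) *
  \prod_(i in I) \prod_(j in S :\: I) (th (q * y j / y i) / th (y j / y i)).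
  by rewrite -big_split; apply: eq_bigr => i _; rewrite big_setU1.
set D := \prod_(i in I) \prod_(j in S :\: I) _.
set O := \prod_(j in S :\: I) _.
set W := pair_prod I _.
have prodE : \prod_(i in I) (th ((y t)^-1 * y i) * th (a * e * y i / (b / y t)) *
     (th (a * q ^+ #|I| / (e * y i)) * th (b * q ^+ #|S|.+1 * y i) /
      (th (e * y i * y i) * th (a * q ^+ #|I| * y i)))) *
   \prod_(i in I) (th (q * y t / y i) / th (y t / y i)) =
   q ^+ #|I| * \prod_(i in I) (th ((y t)^-1 / q * y i) * th (a * e * y i / (b / y t)) *
     (th (a * q ^+ #|I| / (e * y i)) * th (b * q * q ^+ #|S| * y i) /
      (th (e * y i * y i) * th (a * q ^+ #|I| * y i)))).
  rewrite -big_split -prodr_const -big_split /=; apply: eq_bigr => i iI.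
  have it : t != i by apply: contraNneq tI => ->.
  have := @theta_ratioV (y i / y t) _ _.
  rewrite invf_div mulrA mulf_neq0 ?invr_eq0 // thy // => /(_ isT isT) E.
  have -> : (y t)^-1 / q * y i = y i / y t / q by field; rewrite ?e0 ?yt0 ?q0 ?oner_neq0.
  rewrite exprS (mulrA b) [(y t)^-1 * _]mulrC.
  set U := _ / (th (e * y i * y i) * _).
  set V := th (a * e * y i / (b / y t)).
  transitivity (th (q * y t / y i) / th (y t / y i) * th (y i / y t) * (V * U)).
    by ring.
  by rewrite E; ring.
move: prodE; set P1 := \prod_(i in I) _; set P2 := \prod_(i in I) _.
set P3 := \prod_(i in I) _ => prodE.
have gather (t1 t2 z Q u : K) : u != 0 -> P1 * P2 = Q * P3 ->
    t1 * X1 * z * (u * X2 * (X3 * t2)) * P1 * (u^-1 * O) * (P2 * D) * W =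
    t1 * t2 * (X1 * (z * Q) * (X2 * X3) * P3 * O * D * W).
  move=> u0 E; transitivity ((P1 * P2) * (u / u) * (t1 * X1 * z * X2 * X3 * t2 * O * D * W)).
    by ring.
  by rewrite E divff //; ring.
exact: gather.
Qed.


(** The pair factors of t turn theta(e y_i y_t) into theta(q e y_i y_t), which is
    again the replacement of c = 1/y_t by c/q. *)
Lemma subset_total_node (S : {set T}) t b : t \notin S -> b != 0 ->
  subset_total (t |: S) b (y t)^-1 =
  th (b / a) * th (b * q ^+ #|S|.+1 / (e * y t)) *
    subset_total S (b * q) ((y t)^-1 / q).
Proof.
move=> tS b0; have yt0 := y0 t.
rewrite /subset_total cardsU1 tS add1n pair_prodU1 //; last exact: pair_weightC.
rewrite big_setU1 //=.
have -> : b * (y t)^-1 * y t / a = b / a by field; rewrite ?a0 ?yt0 ?oner_neq0.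
have -> : e * y t / (y t)^-1 = e * y t * y t by rewrite invrK.
have prodE : \prod_(j in S) pair_weight t j *
  \prod_(i in S) (th (b * q ^+ #|S|.+1 / (e * y i)) / th (e * y i * y i) *
     (th (b / y t * y i / a) * th (e * y i / (y t)^-1))) =
  \prod_(i in S) (th (b * q * q ^+ #|S| / (e * y i)) / th (e * y i * y i) *
     (th (b * q * ((y t)^-1 / q) * y i / a) * th (e * y i / ((y t)^-1 / q)))).
  rewrite -big_split; apply: eq_bigr => i iS /=.
  have -> : b * q * ((y t)^-1 / q) = b / y t by field; rewrite ?q0 ?yt0 ?oner_neq0.
  have -> : e * y i / ((y t)^-1 / q) = q * e * y t * y i.
    by field; rewrite ?q0 ?yt0 ?oner_neq0.
  have -> : e * y i / (y t)^-1 = e * y t * y i by rewrite invrK mulrAC.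
  rewrite exprS (mulrA b) /pair_weight.
  set U := _ / th (e * y i * y i); set V := th (b / y t * y i / a).
  have h := they t i.
  by field.
rewrite -prodE; move: (they t t).
set P1 := \prod_(j in S) _; set P2 := \prod_(j in S) _ => h.
by field.
Qed.

(** At c = a q^|S| a proper subset contributes theta(a q^|S| / c) = theta(1), and
    the two sides agree for I = S by the inversion of theta. *)
Lemma subset_identity_full (S : {set T}) b : b != 0 ->
  \sum_(I : {set T} | I \subset S) subset_term S b (a * q ^+ #|S|) I =
  subset_total S b (a * q ^+ #|S|).
Proof.
move=> b0; have qS : q ^+ #|S| != 0 by rewrite expf_neq0.
rewrite (bigD1 S) //= big1 ?addr0 => [|I /andP[IS nIS]]; last first.
  have lt : (#|I| < #|S|)%N.
    by apply: proper_card; rewrite finset.properEneq nIS.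
  rewrite /subset_term; suff -> : shifted (a * q ^+ #|I|.+1 / (a * q ^+ #|S|)) (#|S| - #|I|) = 0.
    by rewrite mul0r mulr0 !mul0r.
  rewrite -(subnSK lt) shiftedSr.
  have -> : a * q ^+ #|I|.+1 / (a * q ^+ #|S|) * q ^+ (#|S| - #|I|.+1) = 1.
    have {1}-> : q ^+ #|S| = q ^+ #|I|.+1 * q ^+ (#|S| - #|I|.+1).
      by rewrite -exprD subnKC.
    by field; rewrite a0 !expf_neq0.
  by rewrite th1 mulr0.
rewrite /subset_term /subset_total subnn finset.setDv !big_set0.
rewrite /shifted !big_geq // !mul1r mulr1.
rewrite [X in _ * X * pair_prod _ _](_ : _ = 1) ?mulr1; last first.
  by apply: big1 => i _; rewrite big_set0.
rewrite mulrC; congr (_ * _).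
rewrite -prodr_const -big_split /=; apply: eq_bigr => i iS.
have yi0 := y0 i.
have h1 := they i i; have h2 := thay #|S| i.
have inv1 (u : K) : u != 0 -> th u = - u * th u^-1.
  by move=> u0; rewrite thV // mulrA mulrNN divff // mul1r.
have -> : a * e * y i / (b * (a * q ^+ #|S|)) = e * y i / (b * q ^+ #|S|).
  by field; rewrite a0 b0 qS.
have -> : b * (a * q ^+ #|S|) * y i / a = b * q ^+ #|S| * y i.
  by field; rewrite a0.
rewrite [th (e * y i / (b * _))]inv1 ?mulf_neq0 ?invr_eq0 ?mulf_neq0 //.
rewrite [th (e * y i / (a * _))]inv1 ?mulf_neq0 ?invr_eq0 ?mulf_neq0 //.
rewrite !invf_div; field.
by rewrite h1 h2 a0 b0 qS.
Qed.

Variables (al be A B : K -> K).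
Hypothesis rank_two : forall u v, u != 0 -> v != 0 ->
  th (u * v) * th (u / v) = al u * A v + be u * B v.

(** The rank two property at l u and c/l. *)
Lemma theta_pair_form (l u : K) : l != 0 -> u != 0 ->
  form (fun c => A (c / l)) (fun c => B (c / l)) 1
    (fun c => th (c * u) * th (l * l * u / c)).
Proof.
move=> l0 u0.
apply: eq_form (form_linear _ _ (al (l * u)) (be (l * u))) => c c0.
rewrite -rank_two ?mulf_neq0 ?invr_eq0 //; congr (th _ * th _).
  by field; rewrite ?l0 ?c0.
by field; rewrite ?l0 ?c0 ?oner_neq0.
Qed.

Lemma subset_term_form (l b : K) (S I : {set T}) : l != 0 -> b != 0 ->
  l * l = a * e / b -> I \subset S ->
  form (fun c => A (c / l)) (fun c => B (c / l)) #|S|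
    (fun c => subset_term S b c I).
Proof.
move=> l0 b0 hl IS; have IS' : (#|I| <= #|S|)%N by apply: subset_leq_card.
set k := (#|S| - #|I|)%N.
pose f (j : 'I_k) c := th (c * (b * q ^+ #|I|.+1 * q ^+ j / e)) *
   th (l * l * (b * q ^+ #|I|.+1 * q ^+ j / e) / c).
pose g i c := th (c * y i) * th (l * l * y i / c).
have hf : form (fun c => A (c / l)) (fun c => B (c / l)) k (fun c => \prod_(j < k) f j c).
  have := @form_prod _ (fun c => A (c / l)) (fun c => B (c / l)) _ (enum 'I_k) predT f.
  rewrite count_predT size_enum_ord => h.
  apply: eq_form (h _) => [c c0|j _]; first by rewrite big_enum.
  by apply: theta_pair_form; rewrite ?mulf_neq0 ?invr_eq0 ?expf_neq0.
have hg : form (fun c => A (c / l)) (fun c => B (c / l)) #|I| (fun c => \prod_(i in I) g i c).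
  have := @form_prod _ (fun c => A (c / l)) (fun c => B (c / l)) _ (enum I) predT g.
  rewrite count_predT -cardE => h.
  apply: eq_form (h _) => [c c0|j _]; first by rewrite big_enum.
  by apply: theta_pair_form.
have := formZ (shifted (b / a) k * (b / a) ^+ #|I| *
  \prod_(i in I) (th (a * q ^+ #|I| / (e * y i)) * th (b * q ^+ #|S| * y i) /
      (th (e * y i * y i) * th (a * q ^+ #|I| * y i))) *
  \prod_(j in S :\: I) (th (a * q ^+ #|I|.+1 * y j))^-1 *
  (\prod_(i in I) \prod_(j in S :\: I) (th (q * y j / y i) / th (y j / y i))) *
  pair_prod I pair_weight) (formM hf hg).
rewrite subnK //; apply: eq_form => c c0.
rewrite /subset_term -/k [in RHS]big_split /=.
have -> : \prod_(i in I) (th (c * y i) * th (a * e * y i / (b * c))) = \prod_(i in I) g i c.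
  apply: eq_bigr => i _; rewrite /g hl; congr (_ * th _).
  by field; rewrite ?b0 ?c0.
have -> : shifted (a * q ^+ #|I|.+1 / c) k * shifted (b * c * q ^+ #|I|.+1 / e) k =
    \prod_(j < k) f j c.
  rewrite /shifted !big_mkord -big_split; apply: eq_bigr => j _ /=.
  rewrite /f hl mulrC; congr (th _ * th _); first by field; rewrite ?e0.
  by field; rewrite ?e0 ?b0 ?c0.
move: (\prod_(j < k) f j c) (\prod_(i in I) g i c) => F G.
by ring.
Qed.

Lemma subset_total_form (l b : K) (S : {set T}) : l != 0 -> b != 0 ->
  l * l = a * e / b ->
  form (fun c => A (c / l)) (fun c => B (c / l)) #|S| (fun c => subset_total S b c).
Proof.
move=> l0 b0 hl.
pose g i c := th (c * (b * y i / a)) * th (l * l * (b * y i / a) / c).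
have hg : form (fun c => A (c / l)) (fun c => B (c / l)) #|S| (fun c => \prod_(i in S) g i c).
  have := @form_prod _ (fun c => A (c / l)) (fun c => B (c / l)) _ (enum S) predT g.
  rewrite count_predT -cardE => h.
  apply: eq_form (h _) => [c c0|j _]; first by rewrite big_enum.
  by apply: theta_pair_form; rewrite ?mulf_neq0 ?invr_eq0.
have := formZ (pair_prod S pair_weight *
  \prod_(i in S) (th (b * q ^+ #|S| / (e * y i)) / th (e * y i * y i))) hg.
apply: eq_form => c c0; rewrite /subset_total -mulrA -big_split; congr (_ * _).
apply: eq_bigr => i _; rewrite /g hl; congr (_ * (th _ * th _)).
  by field; rewrite ?a0.
by field; rewrite ?a0 ?b0 ?c0.
Qed.

(** If (A, B) were proportional at c/l and d/l, the linear form with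
    coefficients al, be at d/l, which vanishes at d/l because theta(1) = 0,
    would vanish at c/l, where it is a product of two nonzero thetas.  If
    (A, B) is zero at d/l, the same contradiction comes from the form of c/l. *)
Lemma independent_nodes (l c d : K) : l != 0 -> c != 0 -> d != 0 ->
  th (c * d / (l * l)) != 0 -> th (c / d) != 0 ->
  A (c / l) * B (d / l) != A (d / l) * B (c / l).
Proof.
move=> l0 c0 d0 h1 h2.
have cl : c / l != 0 by rewrite mulf_neq0 ?invr_eq0.
have dl : d / l != 0 by rewrite mulf_neq0 ?invr_eq0.
have e1 : c / l * (d / l) = c * d / (l * l) by field; rewrite ?l0.
have e2 : c / l / (d / l) = c / d by field; rewrite ?l0 ?d0.
have e3 : d / l / (c / l) = (c / d)^-1 by field; rewrite ?l0 ?d0 ?c0 ?oner_neq0.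
have r1 := rank_two cl dl; have r2 := rank_two dl cl.
have r3 := rank_two dl dl; rewrite divff // th1 mulr0 in r3.
rewrite e1 e2 in r1; rewrite (mulrC (d / l)) e1 e3 thV ?mulf_neq0 ?invr_eq0 // in r2.
have {}r1 : al (c / l) * A (d / l) + be (c / l) * B (d / l) != 0 by rewrite -r1 mulf_neq0.
have {}r2 : al (d / l) * A (c / l) + be (d / l) * B (c / l) != 0.
  by rewrite -r2 !mulf_neq0 // oppr_eq0 !invr_eq0 mulf_neq0 ?invr_eq0.
apply/eqP => E.
have A0 : A (d / l) = 0.
  apply/eqP; move: r2; apply: contraNT => Ad; apply/eqP.
  apply: (mulfI Ad); rewrite mulr0.
  transitivity (A (c / l) * (al (d / l) * A (d / l)) + be (d / l) * (A (d / l) * B (c / l))).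
    by ring.
  rewrite -E; transitivity (A (c / l) * (al (d / l) * A (d / l) + be (d / l) * B (d / l))).
    by ring.
  by rewrite -r3 mulr0.
have B0 : B (d / l) = 0.
  apply/eqP; move: r2; apply: contraNT => Bd; apply/eqP.
  apply: (mulfI Bd); rewrite mulr0.
  transitivity (al (d / l) * (A (c / l) * B (d / l)) + be (d / l) * B (c / l) * B (d / l)).
    by ring.
  rewrite E; transitivity (B (c / l) * (al (d / l) * A (d / l) + be (d / l) * B (d / l))).
    by ring.
  by rewrite -r3 mulr0.
by move: r1; rewrite A0 B0 !mulr0 addr0 eqxx.
Qed.

(** The induction step.  The two theta conditions on b make the interpolation
    points a q^|S| and 1/y_t pairwise independent. *)
Lemma subset_identity_step (S : {set T}) (b l : K) : b != 0 -> l != 0 ->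
  l * l = a * e / b ->
  (forall i, th (b * q ^+ #|S| / (e * y i)) != 0) ->
  (forall i j, th (b / (a * e * y i * y j)) != 0) ->
  (forall (S' : {set T}) (b' c' : K), (#|S'| < #|S|)%N -> b' != 0 -> c' != 0 ->
     \sum_(I : {set T} | I \subset S') subset_term S' b' c' I = subset_total S' b' c') ->
  forall c, c != 0 ->
  \sum_(I : {set T} | I \subset S) subset_term S b c I = subset_total S b c.
Proof.
move=> b0 l0 hl g1 g2 IH c c0; apply/eqP; rewrite -subr_eq0; apply/eqP.
pose D c := \sum_(I : {set T} | I \subset S) subset_term S b c I - subset_total S b c.
suff : D c = 0 by [].
pose A' c := A (c / l); pose B' c := B (c / l).
have fD : form A' B' #|S| D.
  have h1 : form A' B' #|S| (fun c => \sum_(I : {set T} | I \subset S) subset_term S b c I).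
    by apply: form_sum => I IS; apply: subset_term_form.
  have h2 := formZ (-1) (subset_total_form S l0 b0 hl).
  by apply: eq_form (formD h1 h2) => d d0; rewrite /D mulN1r.
have aq0 : a * q ^+ #|S| != 0 by rewrite mulf_neq0 ?expf_neq0.
have yinj i j : i != j -> (y i)^-1 != (y j)^-1.
  move=> ij; apply: contraTneq (thy ij) => /invr_inj ->.
  by rewrite divff // th1 eqxx.
pose nodes := a * q ^+ #|S| :: [seq (y i)^-1 | i <- enum S].
have thVn u : u != 0 -> th u != 0 -> th u^-1 != 0.
  by move=> u0 tu; rewrite thV // mulf_neq0 // oppr_eq0 invr_eq0.
have n0 i : th (a * q ^+ #|S| / (y i)^-1) != 0 by rewrite invrK.
apply: (form_eq0 fD (s := nodes)) => //.
- by rewrite /= size_map -cardE.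
- rewrite /= map_inj_in_uniq ?enum_uniq ?andbT.
    apply/mapP => -[i _ E]; move: (n0 i).
    by rewrite E divff ?th1 ?eqxx // invr_eq0.
  by move=> i j _ _ E; apply/eqP; apply: contra_eqT E; exact: yinj.
- move=> u v; rewrite !inE => /orP[/eqP ->|/mapP[i _ ->]] /orP[/eqP ->|/mapP[j _ ->]].
  + by rewrite eqxx.
  + move=> _; apply: independent_nodes; rewrite ?invr_eq0 //.
    have -> // : a * q ^+ #|S| / y j / (l * l) = b * q ^+ #|S| / (e * y j).
    by rewrite hl; field; rewrite ?a0 ?e0 ?b0 ?y0 ?oner_neq0.
  + move=> _; apply: independent_nodes; rewrite ?invr_eq0 //.
      have -> // : (y i)^-1 * (a * q ^+ #|S|) / (l * l) = b * q ^+ #|S| / (e * y i).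
      by rewrite hl; field; rewrite ?a0 ?e0 ?b0 ?y0 ?oner_neq0.
    rewrite -invf_div; apply: thVn => //.
    by rewrite invrK mulf_neq0.
  + move=> ij; have {}ij : i != j by apply: contra_neq ij => ->.
    apply: independent_nodes; rewrite ?invr_eq0 //.
      have -> // : (y i)^-1 / y j / (l * l) = b / (a * e * y i * y j).
      by rewrite hl; field; rewrite ?a0 ?e0 ?b0 ?y0 ?oner_neq0.
    by rewrite invrK mulrC; exact: thy.
move=> u; rewrite inE => /orP[/eqP ->|/mapP[t]].
  by split=> //; rewrite /D subset_identity_full // subrr.
rewrite mem_enum => tS ->; rewrite invr_eq0 y0; split=> //.
have tD : t \notin S :\ t by rewrite !inE eqxx.
have SE : S = t |: (S :\ t) by rewrite finset.setD1K.
rewrite /D SE subset_total_node //.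
rewrite (bigID (fun I : {set T} => t \in I)) /= big1 ?add0r; last first.
  move=> I /andP[_ tI]; rewrite /subset_term (bigD1 t) //=.
  by rewrite mulVf // th1 !mul0r mulr0 !mul0r.
rewrite (eq_bigl (fun I : {set T} => I \subset S :\ t)); last first.
  by move=> I; rewrite -SE subsetD1.
rewrite (eq_bigr _ (fun I IS => subset_term_node tD b0 IS)) -mulr_sumr IH ?subrr //.
- by rewrite [X in (_ < X)%N](cardsD1 t) tS.
- by rewrite mulf_neq0.
- by rewrite mulf_neq0 ?invr_eq0.
Qed.

End SubsetIdentity.

(** * The subset identity for every b *)

Section ContinuityAtPoint.
Local Open Scope classical_set_scope.
Variables (K : numFieldType) (b0 : K).

Definition cont_at (f : K -> K) : Prop := {for b0, continuous f}.

Lemma cont_cst (u : K) : cont_at (fun=> u).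
Proof. exact: cst_continuous. Qed.

Lemma cont_id : cont_at (fun b => b).
Proof. by move=> A; exact. Qed.

Lemma contM f g : cont_at f -> cont_at g -> cont_at (fun b => f b * g b).
Proof. exact: continuousM. Qed.

Lemma contD f g : cont_at f -> cont_at g -> cont_at (fun b => f b + g b).
Proof. exact: continuousD. Qed.

Lemma contX f n : cont_at f -> cont_at (fun b => f b ^+ n).
Proof.
move=> hf; elim: n => [|n IH].
  have -> : (fun b => f b ^+ 0) = (fun=> 1) by apply/funext => b; rewrite expr0.
  exact: cont_cst.
have -> : (fun b => f b ^+ n.+1) = (fun b => f b * f b ^+ n).
  by apply/funext => b; rewrite exprS.
exact: contM.
Qed.

Lemma cont_prod (I : Type) (s : seq I) (P : pred I) (f : I -> K -> K) :
  (forall i, cont_at (f i)) -> cont_at (fun b => \prod_(i <- s | P i) f i b).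
Proof.
move=> h; elim: s => [|i s IH].
  have -> : (fun b => \prod_(i <- [::] | P i) f i b) = (fun=> 1).
    by apply/funext => b; rewrite big_nil.
  exact: cont_cst.
have -> : (fun b => \prod_(j <- i :: s | P j) f j b) =
   (fun b => (if P i then f i b else 1) * \prod_(j <- s | P j) f j b).
  by apply/funext => b; rewrite big_cons; case: (P i); rewrite ?mul1r.
by apply: contM => //; case: (P i); [exact: h|exact: cont_cst].
Qed.

Lemma cont_sum (I : Type) (s : seq I) (P : pred I) (f : I -> K -> K) :
  (forall i, cont_at (f i)) -> cont_at (fun b => \sum_(i <- s | P i) f i b).
Proof.
move=> h; elim: s => [|i s IH].
  have -> : (fun b => \sum_(i <- [::] | P i) f i b) = (fun=> 0).
    by apply/funext => b; rewrite big_nil.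
  exact: cont_cst.
have -> : (fun b => \sum_(j <- i :: s | P j) f j b) =
   (fun b => (if P i then f i b else 0) + \sum_(j <- s | P j) f j b).
  by apply/funext => b; rewrite big_cons; case: (P i); rewrite ?add0r.
by apply: contD => //; case: (P i); [exact: h|exact: cont_cst].
Qed.

End ContinuityAtPoint.

Section Continuity.
Local Open Scope classical_set_scope.
Variable R : realType.
Local Notation C := (complexField R).
Variable p : C.
Hypothesis p_lt1 : cmod p < 1.

Section AtPoint.
Variable b0 : C.
Local Notation cont_at := (cont_at b0).
Hypothesis b00 : b0 != 0.

(** Stated up to an equation on f so that it applies to arguments in which the
    variable is buried. *)
Lemma cont_theta (u : C) (f : C -> C) : u != 0 -> (forall b, f b = u * b) ->
  cont_at (fun b => theta p (f b)).
Proof.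
move=> u0 fE; have -> : (fun b => theta p (f b)) = (fun b => theta p (u * b)).
  by apply/funext => b; rewrite fE.
exact: theta_scale_continuous.
Qed.

Lemma cont_thetaV (u : C) (f : C -> C) : u != 0 -> (forall b, f b = u / b) ->
  cont_at (fun b => theta p (f b)).
Proof.
move=> u0 fE; have -> : (fun b => theta p (f b)) = (fun b => theta p (u / b)).
  by apply/funext => b; rewrite fE.
apply: (@continuous_comp _ _ _ (fun z : C => u / z) (theta p)).
  by apply: continuousM; [exact: cst_continuous|exact: inv_continuous].
by apply: theta_continuous; rewrite // mulf_neq0 // invr_eq0.
Qed.

End AtPoint.

Variables (q : C) (T : finType) (y : T -> C) (a e : C).
Hypothesis q0 : q != 0.
Hypothesis a0 : a != 0.
Hypothesis e0 : e != 0.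
Hypothesis y0 : forall i, y i != 0.
Local Notation term := (subset_term (theta p) q y a e).
Local Notation total := (subset_total (theta p) q y a e).

Lemma subset_term_continuous (b0 c : C) (S I : {set T}) : b0 != 0 -> c != 0 ->
  cont_at b0 (fun b => term S b c I).
Proof.
move=> b00 c0; rewrite /subset_term /shifted.
do 3! (apply: contM; last exact: cont_cst).
apply: contM; last first.
  apply: cont_prod => i; apply: contM.
    apply: contM; first exact: cont_cst.
    apply: (@cont_thetaV _ _ (a * e * y i / c)) => [//||b].
      by rewrite !mulf_neq0 ?invr_eq0.
    by rewrite invfM; ring.
  apply: contM; last exact: cont_cst.
  apply: contM; first exact: cont_cst.
  apply: (@cont_theta _ _ (q ^+ #|S| * y i)) => [//||b]; last by ring.
  by rewrite mulf_neq0 ?expf_neq0.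
apply: contM; first apply: contM.
- apply: cont_prod => j; apply: (@cont_theta _ _ (q ^+ j / a)) => [//||b]; last by ring.
  by rewrite mulf_neq0 ?expf_neq0 ?invr_eq0.
- by apply: contX; apply: contM; [exact: cont_id|exact: cont_cst].
- apply: contM; first exact: cont_cst.
  apply: cont_prod => j.
  apply: (@cont_theta _ _ (c * q ^+ #|I|.+1 / e * q ^+ j)) => [//||b]; last by ring.
  by rewrite !mulf_neq0 ?expf_neq0 ?invr_eq0.
Qed.

Lemma subset_total_continuous (b0 c : C) (S : {set T}) : b0 != 0 -> c != 0 ->
  cont_at b0 (fun b => total S b c).
Proof.
move=> b00 c0; rewrite /subset_total.
apply: contM; first exact: cont_cst.
apply: cont_prod => i; apply: contM.
  apply: contM; last exact: cont_cst.
  apply: (@cont_theta _ _ (q ^+ #|S| / (e * y i))) => [//||b]; last by ring.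
  by rewrite mulf_neq0 ?expf_neq0 ?invr_eq0 ?mulf_neq0.
apply: contM; last exact: cont_cst.
apply: (@cont_theta _ _ (c * y i / a)) => [//||b]; last by ring.
by rewrite !mulf_neq0 ?invr_eq0.
Qed.

Hypothesis thy : forall i j, i != j -> theta p (y j / y i) != 0.
Hypothesis they : forall i j, theta p (e * y i * y j) != 0.
Hypothesis thay : forall k i, theta p (a * q ^+ k * y i) != 0.

(** The step holds at every z near b other than b itself, since the conditions on
    z exclude isolated points; continuity gives it at b. *)
Theorem subset_identity (S : {set T}) (b c : C) : b != 0 -> c != 0 ->
  \sum_(I : {set T} | I \subset S) term S b c I = total S b c.
Proof.
have [n] := ubnP #|S|; elim: n => // n IH in S b c *; rewrite ltnS => Sn b0 c0.
have [al [be [A [B rank2]]]] := theta_rank_two p_lt1.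
pose D z := \sum_(I : {set T} | I \subset S) term S z c I - total S z c.
suff : D b = 0 by move/eqP; rewrite subr_eq0 => /eqP.
apply: eq0_of_continuous.
  apply: (@contD C b (fun z => \sum_(I : {set T} | I \subset S) term S z c I)
    (fun z => - total S z c)).
    by apply: cont_sum => I; exact: subset_term_continuous.
  have -> : (fun z => - total S z c) = (fun z => -1 * total S z c).
    by apply/funext => z; rewrite mulN1r.
  by apply: contM; [exact: cont_cst|exact: subset_total_continuous].
have FF : Filter (nbhs b) by exact: nbhs_filter.
have n1 : \forall z \near b, forall i, z != b -> theta p (q ^+ #|S| / (e * y i) * z) != 0.
  apply: (@filter_forall _ T (fun i z => z != b ->
    theta p (q ^+ #|S| / (e * y i) * z) != 0) _ FF) => i; apply: theta_neq0_near => //.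
  by rewrite mulf_neq0 ?expf_neq0 ?invr_eq0 ?mulf_neq0.
have n2 : \forall z \near b, forall w : T * T, z != b ->
    theta p ((a * e * y w.1 * y w.2)^-1 * z) != 0.
  apply: (@filter_forall _ (T * T)%type (fun w z => z != b ->
    theta p ((a * e * y w.1 * y w.2)^-1 * z) != 0) _ FF) => i; apply: theta_neq0_near => //.
  by rewrite invr_eq0 !mulf_neq0.
have cb : 0 < cmod b by rewrite cmod_gt0.
have n3 : \forall z \near b, cmod (b - z) <= cmod b / 2.
  by apply: near_cmod; rewrite divr_gt0.
near=> z => zb; have z0 : z != 0.
  have hz : cmod (b - z) <= cmod b / 2 by near: z.
  by apply/eqP => z0; move: hz; rewrite z0 subr0; lra.
pose l : C := sqrtc (a * e / z : R[i]).
have hl : l * l = a * e / z.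
  have := sqr_sqrtc (a * e / z : R[i]); rewrite expr2; exact.
have l0 : l != 0.
  have : l * l != 0 by rewrite hl mulf_neq0 ?invr_eq0 // mulf_neq0.
  by apply: contraNneq => ->; rewrite mul0r.
have h1 : forall i, z != b -> theta p (q ^+ #|S| / (e * y i) * z) != 0 by near: z.
have h2 : forall w : T * T, z != b -> theta p ((a * e * y w.1 * y w.2)^-1 * z) != 0 by near: z.
have g1 i : theta p (z * q ^+ #|S| / (e * y i)) != 0.
  have -> : z * q ^+ #|S| / (e * y i) = q ^+ #|S| / (e * y i) * z by ring.
  exact: h1.
have g2 i j : theta p (z / (a * e * y i * y j)) != 0.
  by rewrite [z / _]mulrC; exact: (h2 (i, j)).
have IH' (S' : {set T}) (b' c' : C) : (#|S'| < #|S|)%N -> b' != 0 -> c' != 0 ->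
    \sum_(I : {set T} | I \subset S') term S' b' c' I = total S' b' c'.
  by move=> lt; apply: IH; exact: leq_trans lt Sn.
have step := subset_identity_step (theta1 p_lt1) (@thetaV _ _ p_lt1)
  q0 a0 e0 y0 thy they thay rank2 z0 l0 hl g1 g2 IH' c0.
by rewrite /D step subrr.
Unshelve. all: by end_near.
Qed.

End Continuity.

(** * Initial segments of progressions *)

Section Segments.
Variables (n : nat) (N : 'I_n -> nat).

(** The cell (r, u) stands for the number x_r q^u. *)
Definition cell := {r : 'I_n & 'I_(N r)}.

Definition seg (k : 'I_n -> nat) : {set cell} := [set t : cell | (tagged t < k (tag t))%N].

Lemma big_seg (R : Type) (idx : R) (op : Monoid.com_law idx) (k : 'I_n -> nat)
    (G : 'I_n -> nat -> R) : (forall r, (k r <= N r)%N) ->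
  \big[op/idx]_(t in seg k) G (tag t) (tagged t) =
  \big[op/idx]_(r < n) \big[op/idx]_(0 <= u < k r) G r u.
Proof.
move=> kN.
transitivity (\big[op/idx]_(t : cell | predT (tag t) && (tagged t < k (tag t))%N)
   G (tag t) (tagged t)).
  by apply: eq_bigl => t; rewrite inE.
rewrite -(@sig_big_dep _ idx op 'I_n (fun r => 'I_(N r)) predT
  (fun r (u : 'I_(N r)) => (u < k r)%N) (fun r u => G r u)) /=.
by apply: eq_bigr => r _; rewrite big_mkord (big_ord_widen _ (G r) (kN r)).
Qed.

Lemma big_cseg (R : Type) (idx : R) (op : Monoid.com_law idx) (k : 'I_n -> nat)
    (G : 'I_n -> nat -> R) :
  \big[op/idx]_(t in [set: cell] :\: seg k) G (tag t) (tagged t) =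
  \big[op/idx]_(r < n) \big[op/idx]_(k r <= u < N r) G r u.
Proof.
transitivity (\big[op/idx]_(t : cell | predT (tag t) && (k (tag t) <= tagged t)%N)
   G (tag t) (tagged t)).
  by apply: eq_bigl => t; rewrite !inE andbT -leqNgt.
rewrite -(@sig_big_dep _ idx op 'I_n (fun r => 'I_(N r)) predT
  (fun r (u : 'I_(N r)) => (k r <= u)%N) (fun r u => G r u)) /=.
by apply: eq_bigr => r _; rewrite big_geq_mkord.
Qed.

Lemma card_seg k : (forall r, (k r <= N r)%N) -> #|seg k| = mindex_sum k.
Proof.
move=> kN; rewrite -sum1_card (big_seg _ (fun _ _ => 1%N)) //.
by apply: eq_bigr => r _; rewrite sum_nat_const_nat subn0 muln1.
Qed.

Lemma seg_full : seg N = [set: cell].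
Proof. by apply/finset.setP => t; rewrite !inE ltn_ord. Qed.

(** The length j_r is one more than the largest u with (r, u) in I. *)
Lemma seg_of_closed (I : {set cell}) :
  (forall r (u v : 'I_(N r)), Tagged (fun r => 'I_(N r)) v \in I -> (u : nat).+1 = v ->
     Tagged (fun r => 'I_(N r)) u \in I) ->
  exists j : {dffun forall r : 'I_n, 'I_(N r).+1}, I = seg (fun r => j r).
Proof.
move=> cl; pose tg r (u : 'I_(N r)) : cell := Tagged (fun r => 'I_(N r)) u.
have down r (u v : 'I_(N r)) : tg r v \in I -> (u <= v)%N -> tg r u \in I.
  move=> vI /subnK; move: (v - u)%N => d; elim: d u => [|d IH] u E.
    by have -> // : u = v by apply: val_inj.
  have lt : (u.+1 < N r)%N by rewrite (leq_trans _ (ltn_ord v)) // ltnS -E; lia.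
  by apply: (cl r u (Ordinal lt)) => //; apply: IH; rewrite /= -E; lia.
have jmax r : (\max_(u : 'I_(N r) | tg r u \in I) u.+1 < (N r).+1)%N.
  by rewrite ltnS; apply/bigmax_leqP => u _.
exists [ffun r => Ordinal (jmax r)]; apply/finset.setP => -[r u].
rewrite inE ffunE /=; apply/idP/idP => [uI|].
  exact: (@leq_bigmax_cond _ (fun u => tg r u \in I) (fun u : 'I_(N r) => u.+1) u uI).
rewrite ltnNge => /negP h; apply: contrapT => uI; apply: h.
apply/bigmax_leqP => v vI; rewrite ltnNge; apply/negP => uv.
by apply: uI; exact: down vI uv.
Qed.

Lemma seg_inj : injective (fun j : {dffun forall r : 'I_n, 'I_(N r).+1} => seg (fun r => j r)).
Proof.
move=> j j' /finset.setP E; apply/ffunP => r; apply: val_inj => /=.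
have half (i i' : {dffun forall r : 'I_n, 'I_(N r).+1}) :
    (forall t, t \in seg (fun r => i r) -> t \in seg (fun r => i' r)) -> (i r <= i' r)%N.
  move=> h; rewrite leqNgt; apply/negP => lt.
  have lt' : (i' r < N r)%N by apply: leq_trans lt _; rewrite -ltnS.
  have := h (Tagged (fun r => 'I_(N r)) (Ordinal lt')); rewrite !inE /= lt ltnn.
  by move=> /(_ isT).
by apply/eqP; rewrite eqn_leq !half // => t; rewrite E.
Qed.

Lemma sum_segments (V : nmodType) (F : {set cell} -> V) :
  (forall (I : {set cell}) (t u : cell), t \in I -> u \notin I -> tag t = tag u ->
     (tagged u : nat).+1 = tagged t -> F I = 0) ->
  \sum_(I : {set cell} | I \subset [set: cell]) F I =
  \sum_(j : {dffun forall r : 'I_n, 'I_(N r).+1}) F (seg (fun r => j r)).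
Proof.
move=> F0; pose sg (j : {dffun forall r : 'I_n, 'I_(N r).+1}) := seg (fun r => j r).
rewrite (eq_bigl predT) => [|I]; last by rewrite finset.subsetT.
rewrite (bigID (fun I => I \in sg @: finset.setT)) /= [X in _ + X]big1 ?addr0.
  by rewrite big_imset => [|i j _ _]; [apply: eq_bigl => j; rewrite inE|exact: seg_inj].
move=> I nI; apply: contrapT => FI; apply/negP: nI; rewrite negbK.
have [|j ->] := seg_of_closed (I := I); last by apply: imset_f; rewrite inE.
move=> r u v vI uv; apply: contrapT => /negP uI.
by apply: FI; exact: (F0 I _ _ vI uI).
Qed.

End Segments.

(** * Shifted factorials as products over cells *)

Section ProductsOverSegments.
Variables (K : fieldType) (th : K -> K) (q : K) (n : nat) (N : 'I_n -> nat).
Variables (x : 'I_n -> K) (a e : K).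
Hypothesis q0 : q != 0.
Hypothesis x0 : forall r, x r != 0.
Local Notation cell := (cell N).
Local Notation seg := (@seg n N).
Local Notation sh := (shifted th q).

Definition node (t : cell) : K := x (tag t) * q ^+ tagged t.

Lemma shiftedD u k m : sh u (k + m) = sh u k * \prod_(k <= i < k + m) th (u * q ^+ i).
Proof. by rewrite /shifted (@big_cat_nat _ _ _ k) ?leq_addr. Qed.

Lemma shiftedE u v k m : (forall i, v * q ^+ i = u * q ^+ (k + i)) ->
  sh u (k + m) = sh u k * sh v m.
Proof.
move=> uv; rewrite shiftedD; congr (_ * _); rewrite /shifted -{1}[k]add0n big_addn addKn.
by apply: eq_big_nat => i _; rewrite uv addnC.
Qed.

(** The last k factors, read backwards. *)
Lemma shifted_rev u m k : (k <= m)%N ->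
  sh u m = sh u (m - k) * \prod_(0 <= i < k) th (u * q ^+ m / q ^+ i.+1).
Proof.
move=> km; rewrite -{1}(subnK km) shiftedD subnK //; congr (_ * _).
rewrite [RHS]big_nat_rev /= -{1}[(m - k)%N]add0n big_addn subKn //.
apply: eq_big_nat => i /andP[_ ik]; congr (th _); rewrite -mulrA; congr (_ * _).
have -> : (0 + k - i.+1).+1 = (k - i)%N by lia.
apply: (mulIf (expf_neq0 (k - i) q0)); rewrite divfK ?expf_neq0 // -exprD.
by congr (_ ^+ _); lia.
Qed.

Lemma prod_seg_nat (k : 'I_n -> nat) (F : cell -> K) (G : 'I_n -> nat -> K) :
  (forall r, (k r <= N r)%N) -> (forall t, F t = G (tag t) (tagged t)) ->
  \prod_(t in seg k) F t = \prod_(r < n) \prod_(0 <= u < k r) G r u.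
Proof. by move=> kN FG; rewrite -(@big_seg n N) //; apply: eq_bigr. Qed.

Lemma prod_cseg_nat (k : 'I_n -> nat) (F : cell -> K) (G : 'I_n -> nat -> K) :
  (forall t, F t = G (tag t) (tagged t)) ->
  \prod_(t in [set: cell] :\: seg k) F t = \prod_(r < n) \prod_(k r <= u < N r) G r u.
Proof. by move=> FG; rewrite -(@big_cseg n N) //; apply: eq_bigr. Qed.

Lemma prod_seg_shifted (k : 'I_n -> nat) u : (forall r, (k r <= N r)%N) ->
  \prod_(t in seg k) th (u * node t) = \prod_(r < n) sh (u * x r) (k r).
Proof.
move=> kN; rewrite (prod_seg_nat (G := fun r i => th (u * x r * q ^+ i))) // => t.
by rewrite mulrA.
Qed.

(** Absorbs the factors (b x_r)_(k_r + m) of the matrix. *)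
Lemma prod_seg_tail (k : 'I_n -> nat) (u : K) m : (forall r, (k r <= N r)%N) ->
  (\prod_(r < n) sh (u * x r) m) * \prod_(t in seg k) th (u * q ^+ m * node t) =
  \prod_(r < n) sh (u * x r) (k r + m).
Proof.
move=> kN; rewrite prod_seg_shifted // -big_split; apply: eq_bigr => r _ /=.
by rewrite addnC (@shiftedE (u * x r) (u * q ^+ m * x r)) // => i; rewrite exprD; ring.
Qed.

(** Absorbs the quotients (d/x_r)_J / (d/x_r)_(J - k_r) of the sequences. *)
Lemma prod_seg_rev (k : 'I_n -> nat) (u v : K) m : (forall r, (k r <= m)%N) ->
  (forall r, (k r <= N r)%N) -> v = u * q ^+ m / q ->
  (\prod_(r < n) sh (u / x r) (m - k r)) * \prod_(t in seg k) th (v / node t) =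
  \prod_(r < n) sh (u / x r) m.
Proof.
move=> km kN vE; rewrite (prod_seg_nat (G := fun r i => th (u / x r * q ^+ m / q ^+ i.+1))) //.
  by rewrite -big_split; apply: eq_bigr => r _ /=; rewrite -shifted_rev.
move=> t; rewrite vE /node exprS; congr (th _); field.
by rewrite q0 x0 expf_neq0.
Qed.

(** Both sides are the factorials (a x_r)_(N_r + m + 1): the selected cells give
    the indices from m on, the theta of the very-well-poised part the index
    k_r + m, and the remaining cells the indices after it. *)
Lemma prod_poised (k : 'I_n -> nat) m : (forall r, (k r <= N r)%N) ->
  \prod_(t in seg k) th (a * q ^+ m * node t) *
  \prod_(t in [set: cell] :\: seg k) th (a * q ^+ m.+1 * node t) *
  (\prod_(r < n) th (a * x r * q ^+ (k r + m)) * \prod_(r < n) sh (a * x r) m) =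
  \prod_(r < n) th (a * x r) * \prod_(r < n) sh (a * x r * q) (N r + m).
Proof.
move=> kN.
rewrite (prod_seg_nat (G := fun r i => th (a * q ^+ m * x r * q ^+ i))) //; last first.
  by move=> t; rewrite /node mulrA.
rewrite (@prod_cseg_nat _ _ (fun r i => th (a * x r * q ^+ (m.+1 + i)))); last first.
  by move=> t; rewrite /node exprD; congr (th _); ring.
rewrite -!big_split /=; apply: eq_bigr => r _.
rewrite -shiftedSl.
have -> : ((N r + m).+1 = (m + k r).+1 + (N r - k r))%N by have := kN r; lia.
rewrite shiftedD shiftedSr (@shiftedE (a * x r) (a * q ^+ m * x r) m (k r)); last first.
  by move=> i; rewrite exprD; ring.
have -> : \prod_(k r <= u < N r) th (a * x r * q ^+ (m.+1 + u)) =
  \prod_((m + k r).+1 <= i < (m + k r).+1 + (N r - k r)) th (a * x r * q ^+ i).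
  have -> : (m + k r).+1 = (k r + m.+1)%N by lia.
  rewrite big_addn; have -> : (k r + m.+1 + (N r - k r) - m.+1 = N r)%N by have := kN r; lia.
  by apply: eq_big_nat => i _; rewrite addnC.
rewrite /shifted (addnC (k r)); ring.
Qed.

Hypothesis thx : forall r s (m : int), (r != s) || (m != 0) -> th (q ^ m * x r / x s) != 0.
Hypothesis thex : forall r s m, th (e * x r * x s * q ^+ m) != 0.

(** For fixed r, s and v the product over u < k_s telescopes, both factors being
    values of theta(q^m x_r/x_s) at consecutive m. *)
Lemma prod_seg_cseg (k : 'I_n -> nat) : (forall r, (k r <= N r)%N) ->
  \prod_(i in seg k) \prod_(j in [set: cell] :\: seg k)
     (th (q * node j / node i) / th (node j / node i)) =
  \prod_(r < n) \prod_(s < n) sh (q * x r / x s) (N r) /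
  \prod_(r < n) \prod_(s < n) (sh (q * x r / x s) (k r) *
     sh (q ^ (1 + (k r)%:Z - (k s)%:Z) * x r / x s) (N r - k r)).
Proof.
move=> kN.
transitivity (\prod_(s < n) \prod_(0 <= u < k s) \prod_(r < n) \prod_(k r <= v < N r)
   (th (q ^ (1 + v%:Z - u%:Z) * x r / x s) / th (q ^ (v%:Z - u%:Z) * x r / x s))).
  apply: prod_seg_nat => // t; apply: prod_cseg_nat => t'.
  have E m : q ^ (m + (tagged t')%:Z - (tagged t)%:Z) * x (tag t') / x (tag t) =
     q ^ m * node t' / node t.
    rewrite /node !expfzDr // -exprz_inv -!exprnP exprVn; field.
    by rewrite x0 expf_neq0.
  have E0 := E 0; rewrite add0r expr0z mul1r in E0.
  by rewrite E E0 expr1z.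
transitivity (\prod_(s < n) \prod_(r < n) \prod_(k r <= v < N r) \prod_(0 <= u < k s)
   (th (q ^ (1 + v%:Z - u%:Z) * x r / x s) / th (q ^ (v%:Z - u%:Z) * x r / x s))).
  apply: eq_bigr => s _; rewrite exchange_big; apply: eq_bigr => r _.
  by rewrite exchange_big.
rewrite exchange_big -prodf_div; apply: eq_bigr => r _.
rewrite -prodf_div; apply: eq_bigr => s _ /=.
have tele (v m : nat) : (k r <= v)%N -> (m <= k s)%N ->
  \prod_(0 <= u < m) (th (q ^ (1 + v%:Z - u%:Z) * x r / x s) / th (q ^ (v%:Z - u%:Z) * x r / x s)) =
  th (q ^ (1 + v%:Z) * x r / x s) / th (q ^ (1 + v%:Z - m%:Z) * x r / x s).
  move=> kv; elim: m => [|m IH] mk.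
    rewrite big_geq // subr0 divff // thx //; lia.
  have nz i : (i < k s)%N -> th (q ^ (v%:Z - i%:Z) * x r / x s) != 0.
    move=> ik; apply: thx; have [rs|//] := eqVneq r s; rewrite rs in kv *; lia.
  rewrite big_nat_recr //= IH ?(ltnW mk) //.
  have -> : 1 + v%:Z - m.+1%:Z = v%:Z - m%:Z by lia.
  have h1 : th (q ^ (1 + v%:Z - m%:Z) * x r / x s) != 0.
    apply: thx; have [rs|//] := eqVneq r s; rewrite rs in kv *; lia.
  have h2 := nz m mk.
  by field; rewrite h1 h2.
transitivity (\prod_(k r <= v < N r) (th (q ^ (1 + v%:Z) * x r / x s) /
    th (q ^ (1 + v%:Z - (k s)%:Z) * x r / x s))).
  by apply: eq_big_nat => v /andP[kv _]; exact: tele.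
have shn i : sh (q * x r / x s) i != 0.
  rewrite /shifted prodf_seq_neq0; apply/allP => j _ /=.
  have -> : q * x r / x s * q ^+ j = q ^ (1 + j%:Z) * x r / x s.
    by rewrite expfzDr // expr1z -exprnP; ring.
  by apply: thx; lia.
have -> : sh (q * x r / x s) (N r) = sh (q * x r / x s) (k r) *
    \prod_(k r <= i < N r) th (q * x r / x s * q ^+ i).
  by rewrite -{1}(subnKC (kN r)) shiftedD subnKC.
rewrite prodf_div invfM.
rewrite [RHS]mulrACA divff // mul1r.
congr (_ / _).
  apply: eq_big_nat => v _; congr th; rewrite expfzDr // expr1z -exprnP; ring.
rewrite /shifted -{1}[k r]add0n big_addn; apply: eq_big_nat => v _; congr th.
have -> : 1 + (v + k r)%:Z - (k s)%:Z = 1 + (k r)%:Z - (k s)%:Z + v%:Z by lia.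
by rewrite [in LHS]expfzDr // -exprnP; ring.
Qed.

(** Induction on the sum of the k_r.  Adding the cell (t, k_t) multiplies the pair
    product by a product over s that telescopes in the cells of row s, and the
    right-hand side by the same factors. *)
Lemma prod_seg_pairs (k : 'I_n -> nat) : (forall r, (k r <= N r)%N) ->
  pair_prod (seg k) (pair_weight th q node e) /
    \prod_(t in seg k) th (e * node t * node t) =
  \prod_(r < n) \prod_(s < n | (r < s)%N) sh (e * x r * x s) (k r + k s) /
  \prod_(r < n) \prod_(s < n) sh (e * x r * x s) (k r).
Proof.
have shn r s i : sh (e * x r * x s) i != 0.
  by rewrite /shifted prodf_seq_neq0; apply/allP => j _ /=; exact: thex.
have theyy (t : cell) : th (e * node t * node t) != 0.
  rewrite /node (_ : _ * _ = e * x (tag t) * x (tag t) * q ^+ (tagged t + tagged t)) ?thex //.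
  by rewrite exprD; ring.
have [m] := ubnP (\sum_(r < n) k r); elim: m => // m IH in k *; rewrite ltnS => km kN.
have [/forallP k0|] := boolP [forall r, k r == 0%N].
  have -> : seg k = finset.set0.
    by apply/finset.setP => t; rewrite !inE (eqP (k0 _)).
  rewrite /pair_prod !big_set0 invr1 mulr1 !big1 ?divr1 ?invr1 // => r _.
    by apply: big1 => s _; rewrite (eqP (k0 r)) /shifted big_geq.
  by apply: big1 => s _; rewrite (eqP (k0 r)) (eqP (k0 s)) /shifted big_geq.
rewrite negb_forall => /existsP[t]; rewrite -lt0n => kt.
pose k' r := if r == t then (k r).-1 else k r.
have k'N r : (k' r <= N r)%N.
  by rewrite /k'; case: eqP => // _; apply: leq_trans (leq_pred _) (kN r).
have k't : k t = (k' t).+1 by rewrite /k' eqxx prednK.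
have k'r r : r != t -> k' r = k r by rewrite /k' => /negbTE ->.
have ltN : (k' t < N t)%N by rewrite -k't.
pose c : cell := Tagged (fun r => 'I_(N r)) (Ordinal ltN).
have segE : seg k = c |: seg k'.
  apply/finset.setP => -[r u]; rewrite !inE -tag_eqE /tag_eq /=.
  have [rt|rt] := eqVneq r t; last by rewrite /= k'r.
  by subst r; rewrite /= tagged_asE -val_eqE /= k't ltnS leq_eqVlt.
have cN : c \notin seg k' by rewrite inE /= ltnn.
have {}IH : pair_prod (seg k') (pair_weight th q node e) =
    \prod_(r < n) \prod_(s < n | (r < s)%N) sh (e * x r * x s) (k' r + k' s) /
    \prod_(r < n) \prod_(s < n) sh (e * x r * x s) (k' r) *
    \prod_(t in seg k') th (e * node t * node t).
  rewrite -IH ?divfK //.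
  - by rewrite prodf_seq_neq0; apply/allP => j _; apply/implyP => _; exact: theyy.
  - apply: leq_trans km; rewrite (bigD1 t) //= [X in (_ < X)%N](bigD1 t) //= k't addSn ltnS.
    by rewrite leq_add2l; apply: leq_sum => r rt; rewrite k'r.
pose U s := th (e * x t * x s * q ^+ k' t).
pose V s := th (e * x t * x s * q ^+ (k' t + k' s)).
have weights : \prod_(j in seg k') pair_weight th q node e c j =
    \prod_(s < n) V s / \prod_(s < n) U s.
  rewrite (prod_seg_nat (G := fun s v => th (e * x t * x s * q ^+ (k' t + v.+1)) /
     th (e * x t * x s * q ^+ (k' t + v)))) //; last first.
    move=> j; rewrite /pair_weight /node /= !exprD exprS.
    by congr (th _ / th _); ring.
  rewrite -prodf_div; apply: eq_bigr => s _.
  rewrite /V /U; elim: (k' s) => [|i IHi]; first by rewrite big_geq // addn0 divff.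
  rewrite big_nat_recr //= IHi; have h1 := thex t s (k' t + i); have h2 := thex t s (k' t).
  by field; rewrite h1 h2.
have pn (l : 'I_n -> nat) : \prod_(r < n) \prod_(s < n | (r < s)%N) sh (e * x r * x s) (l r + l s) =
    pair_prod [set: 'I_n] (fun r s => sh (e * x r * x s) (l r + l s)).
  rewrite /pair_prod; apply: eq_big => [r|r _]; first by rewrite inE.
  by apply: eq_bigl => s; rewrite inE !enum_rank_ord.
have pnt (l : 'I_n -> nat) :
    \prod_(r < n) \prod_(s < n | (r < s)%N) sh (e * x r * x s) (l r + l s) =
    pair_prod ([set: 'I_n] :\ t) (fun r s => sh (e * x r * x s) (l r + l s)) *
    \prod_(s < n | s != t) sh (e * x t * x s) (l t + l s).
  rewrite pn -{1}(finset.setD1K (finset.in_setT t)) pair_prodU1 ?inE ?eqxx //.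
    by congr (_ * _); apply: eq_bigl => s; rewrite !inE andbT.
  by move=> r s; rewrite addnC mulrAC.
have num : \prod_(r < n) \prod_(s < n | (r < s)%N) sh (e * x r * x s) (k r + k s) =
    \prod_(r < n) \prod_(s < n | (r < s)%N) sh (e * x r * x s) (k' r + k' s) *
    \prod_(s < n | s != t) V s.
  rewrite !pnt -mulrA -big_split /=; congr (_ * _).
    apply: eq_bigr => r; rewrite !inE => /andP[rt _]; apply: eq_bigr => s.
    by rewrite !inE => /andP[/andP[st _] _]; rewrite !k'r.
  by apply: eq_bigr => s st; rewrite k't (k'r s st) addSn shiftedSr /V (k'r s st).
have den : \prod_(r < n) \prod_(s < n) sh (e * x r * x s) (k r) =
    \prod_(r < n) \prod_(s < n) sh (e * x r * x s) (k' r) * \prod_(s < n) U s.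
  rewrite (bigD1 t) //= [in RHS](bigD1 t) //= mulrAC -big_split /=; congr (_ * _).
    by apply: eq_bigr => s _; rewrite k't shiftedSr.
  by apply: eq_bigr => r rt; rewrite k'r.
rewrite segE pair_prodU1 //; last exact: pair_weightC.
have VD : \prod_(s < n) V s = th (e * node c * node c) * \prod_(s < n | s != t) V s.
  rewrite (bigD1 t) //=; congr (_ * _); rewrite /V /node /= exprD; congr th; ring.
rewrite big_setU1 //= IH weights num den VD.
have n1 := theyy c.
have n2 : \prod_(t in seg k') th (e * node t * node t) != 0.
  by rewrite prodf_seq_neq0; apply/allP => j _; apply/implyP => _; exact: theyy.
have n3 : \prod_(s < n) U s != 0.
  by rewrite prodf_seq_neq0; apply/allP => j _; exact: thex.
have n4 : \prod_(r < n) \prod_(s < n) sh (e * x r * x s) (k' r) != 0.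
  rewrite prodf_seq_neq0; apply/allP => r _.
  by rewrite prodf_seq_neq0; apply/allP => s _; exact: shn.
by field; rewrite n1 n2 n3 n4.
Qed.

End ProductsOverSegments.

(** * The Bailey sum as a sum over subsets *)

(** The cancellations that are left in the comparison of a summand with a term
    of the subset sum, once all products have been named. *)
Lemma regroup (F : fieldType)
    (S Bd Wb Ep AA OO T1 Aj T0 Pk Ka Ed C1 C2 Dk Dp G1 G2 G1' G2' H EE z : F) :
  Bd != 0 -> EE != 0 -> AA != 0 -> OO != 0 -> T1 != 0 -> Aj != 0 -> T0 != 0 ->
  Ed != 0 -> Ka != 0 -> H != 0 -> Dk != 0 -> G1 != 0 -> G1' != 0 -> G2 != 0 -> G2' != 0 ->
  S / Bd * (Wb * Ep / (AA * OO * (T1 * Aj) / T0)) *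
    (T1 / T0 * (Pk / (Ka * Ed)) * (C1 * C2 * (Aj * (Dk * Dp)) / (G1 * G2 * Dk)) * z) =
  Wb / H / (G1 * G1' * (G2 * G2')) *
    (S * z * (G1' * G2') * (C1 * C2 * (Dp * Ep / (EE * AA))) / OO *
     (H / (Ka * Bd)) * (Pk / Ed * EE)).
Proof.
move=> h1 h2 h3 h4 h5 h6 h7 h8 h9 h10 h11 h12 h13 h14 h15; field.
by rewrite h1 h2 h3 h4 h5 h6 h7 h8 h9 h10 h11 h12 h13 h14 h15.
Qed.

Section Assembly.
Variables (K : numFieldType) (q p : K) (n : nat) (x : 'I_n -> K) (N : 'I_n -> nat).
Variables (a b c d : K).
Hypothesis q0 : q != 0.
Hypothesis x0 : forall r, x r != 0.
Hypothesis a0 : a != 0.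
Hypothesis b0 : b != 0.
Hypothesis c0 : c != 0.
Hypothesis d0 : d != 0.
Local Notation th := (theta p).
Local Notation sh := (shifted th q).
Local Notation cell := (cell N).
Local Notation seg := (@seg n N).
Let e := a * q / d.
Let y : cell -> K := node q x (N := N).
Let M := mindex_sum N.

Hypothesis thx : forall r s (m : int), (r != s) || (m != 0) -> th (q ^ m * x r / x s) != 0.
Hypothesis thex : forall r s m, th (e * x r * x s * q ^+ m) != 0.
Hypothesis thax : forall r m, th (a * x r * q ^+ m) != 0.
Hypothesis shc : sh (a * q / c) M != 0.
Hypothesis shd : sh (b * c * d / a) M != 0.

Lemma qpfactE u m : qpfact q p u (Posz m) = sh u m.
Proof. by []. Qed.

Lemma qpfactB u m k : (k <= m)%N -> qpfact q p u (m%:Z - k%:Z) = sh u (m - k).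
Proof. by move=> km; rewrite subzn. Qed.

Lemma prod_neq0 (I : finType) (P : pred I) (F : I -> K) :
  (forall i, F i != 0) -> \prod_(i | P i) F i != 0.
Proof. by move=> F0; rewrite prodf_seq_neq0; apply/allP => i _; apply/implyP. Qed.

Lemma shifted_neq0 u m : (forall i, th (u * q ^+ i) != 0) -> sh u m != 0.
Proof. by move=> h; rewrite /shifted prodf_seq_neq0; apply/allP => i _; exact: h. Qed.

Lemma shqx_neq0 r s m : sh (q * x r / x s) m != 0.
Proof.
apply: shifted_neq0 => i.
have -> : q * x r / x s * q ^+ i = q ^ (1 + i%:Z) * x r / x s.
  by rewrite expfzDr // expr1z -exprnP; ring.
by apply: thx; lia.
Qed.

Lemma shex_neq0 r s m : sh (e * x r * x s) m != 0.
Proof. by apply: shifted_neq0 => i; exact: thex. Qed.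

Lemma y_neq0 t : y t != 0.
Proof. by rewrite /y /node mulf_neq0 ?expf_neq0. Qed.

Lemma theyy t : th (e * y t * y t) != 0.
Proof.
have -> : e * y t * y t = e * x (tag t) * x (tag t) * q ^+ (tagged t + tagged t).
  by rewrite /y /node exprD; ring.
exact: thex.
Qed.

(** The factors that do not depend on the summation index. *)
Definition prefactor : K :=
  \prod_(r < n) sh (b * x r) M / \prod_(r < n) \prod_(s < n) sh (q * x r / x s) (N r) /
  (sh (a * q / c) M * sh (b * c * d / a) M).

Lemma beta1_subset_total :
  (forall r, sh (b * d / a / x r) (M - N r) != 0) ->
  beta1 q p x c d a b N = prefactor * subset_total th q y a e [set: cell] b c.
Proof.
move=> shz; have NN r : (N r <= N r)%N by [].
have NM r : (N r <= M)%N by rewrite /M /mindex_sum (bigD1 r) //= leq_addr.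
have cardM : #|[set: cell]| = M by rewrite -seg_full card_seg.
have ex r s : a * x r * x s * q / d = e * x r * x s by rewrite /e; ring.
pose Pk := \prod_(r < n) \prod_(s < n | (r < s)%N) sh (e * x r * x s) (N r + N s).
pose Ed := \prod_(r < n) \prod_(s < n) sh (e * x r * x s) (N r).
pose H := \prod_(r < n) \prod_(s < n) sh (q * x r / x s) (N r).
pose Wb := \prod_(r < n) sh (b * x r) M.
pose Zn := \prod_(r < n) sh (b * d / a / x r) M.
pose Zd := \prod_(r < n) sh (b * d / a / x r) (M - N r).
pose X1 := \prod_(r < n) sh (e / c * x r) (N r).
pose X2 := \prod_(r < n) sh (b * c / a * x r) (N r).
pose G1 := sh (a * q / c) M.
pose G2 := sh (b * c * d / a) M.
have zx r : b * d / (a * x r) = b * d / a / x r by rewrite invfM mulrA.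
have bE : beta1 q p x c d a b N = Pk / (Ed * H) * (Wb * Zn / Zd) * (X1 * X2 / (G1 * G2)).
  rewrite /beta1 -/M.
  have -> : \prod_(r < n) \prod_(s < n | (r < s)%N)
      qpfact q p (a * x r * x s * q / d) (N r + N s)%N = Pk.
    by apply: eq_bigr => r _; apply: eq_bigr => s _; rewrite ex.
  have -> : \prod_(r < n) \prod_(s < n) (qpfact q p (a * x r * x s * q / d) (N r) *
      qpfact q p (q * x r / x s) (N r)) = Ed * H.
    rewrite -big_split; apply: eq_bigr => r _; rewrite -big_split; apply: eq_bigr => s _.
    by rewrite ex.
  have -> : \prod_(r < n) (qpfact q p (b * x r) M * qpfact q p (b * d / (a * x r)) M /
      qpfact q p (b * d / (a * x r)) (M%:Z - (N r)%:Z)) = Wb * Zn / Zd.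
    rewrite -big_split -prodf_div; apply: eq_bigr => r _.
    by rewrite qpfactB // zx.
  have -> // : \prod_(r < n) (qpfact q p (a * x r * q / (c * d)) (N r) *
      qpfact q p (b * c * x r / a) (N r)) = X1 * X2.
  rewrite -big_split; apply: eq_bigr => r _; rewrite !qpfactE.
  by congr (sh _ _ * sh _ _); rewrite /e ?invfM; ring.
pose EE := \prod_(t in seg N) th (e * y t * y t).
pose Zp := \prod_(t in seg N) th (b * q ^+ M / (e * y t)).
pose PP := pair_prod (seg N) (pair_weight th q y e).
have tE : subset_total th q y a e [set: cell] b c = PP * (Zp / EE * (X2 * X1)).
  rewrite /subset_total cardM -seg_full -/PP big_split /= prodf_div -/EE -/Zp big_split /=.
  rewrite /X1 /X2 -!(prod_seg_shifted th q x _ NN); congr (_ * (_ * (_ * _))).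
    by apply: eq_bigr => t _; congr th; rewrite -/(y t); ring.
  by apply: eq_bigr => t _; congr th; rewrite -/(y t); ring.
have f1 : Zd * Zp = Zn.
  have h := prod_seg_rev th q0 x0 NM NN (erefl (b * d / a * q ^+ M / q)).
  rewrite /Zn -h; congr (_ * _); apply: eq_bigr => t _; congr th.
  by rewrite /e -/(y t); field; rewrite ?a0 ?d0 ?q0 ?y_neq0.
have f2 : PP / EE = Pk / Ed by exact: prod_seg_pairs.
have n1 : EE != 0 by apply: prod_neq0 => t; exact: theyy.
have n2 : Zd != 0 by apply: prod_neq0.
have n3 : Ed != 0 by apply: prod_neq0 => r; apply: prod_neq0 => s; exact: shex_neq0.
have n4 : H != 0 by apply: prod_neq0 => r; apply: prod_neq0 => s; exact: shqx_neq0.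
rewrite bE tE /prefactor -/H -/Wb -/G1 -/G2 -f1.
have {f2}-> : PP = Pk / Ed * EE by rewrite -f2 divfK.
by field; rewrite n1 n2 n3 n4 shc shd.
Qed.

Lemma summand_subset_term (k : 'I_n -> nat) : (forall r, (k r <= N r)%N) ->
  (forall r, sh (d / x r) (mindex_sum k - k r) != 0) ->
  B1 q p x a b N k * alpha1 q p x c d a b k =
  prefactor * subset_term th q y a e [set: cell] b c (seg k).
Proof.
move=> kN shdx; set J := mindex_sum k.
have JM : (J <= M)%N by apply: leq_sum => r _; exact: kN.
have kJ r : (k r <= J)%N by rewrite /J /mindex_sum (bigD1 r) //= leq_addr.
have cardM : #|[set: cell]| = M by rewrite -seg_full card_seg.
have cardJ : #|seg k| = J by rewrite card_seg.
pose Bd := \prod_(r < n) \prod_(s < n) sh (q ^ (1 + (k r)%:Z - (k s)%:Z) * x r / x s) (N r - k r).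
pose Bn := \prod_(r < n) sh (b * x r) (k r + M).
pose An := \prod_(r < n) sh (a * x r * q) (N r + J).
pose T0 := \prod_(r < n) th (a * x r).
pose T1 := \prod_(r < n) th (a * x r * q ^+ (k r + J)).
pose Pk := \prod_(r < n) \prod_(s < n | (r < s)%N) sh (e * x r * x s) (k r + k s).
pose Ka := \prod_(r < n) \prod_(s < n) sh (q * x r / x s) (k r).
pose Ed := \prod_(r < n) \prod_(s < n) sh (e * x r * x s) (k r).
pose C1 := \prod_(r < n) sh (c * x r) (k r).
pose C2 := \prod_(r < n) sh (a * e / (b * c) * x r) (k r).
pose Aj := \prod_(r < n) sh (a * x r) J.
pose Dj := \prod_(r < n) sh (d / x r) J.
pose Dk := \prod_(r < n) sh (d / x r) (J - k r).
pose G1 := sh (a * q / c) J.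
pose G2 := sh (b * c * d / a) J.
pose S := sh (b / a) (M - J).
have ex r s : a * x r * x s * q / d = e * x r * x s by rewrite /e; ring.
have BE : B1 q p x a b N k = S / Bd * (Bn / An).
  rewrite /B1 -/M -/J qpfactB // -prodf_div; congr (_ / _ * _).
  by apply: eq_bigr => r _; apply: eq_bigr => s _; rewrite qpfactB.
have aE : alpha1 q p x c d a b k =
    (T1 / T0) * (Pk / (Ka * Ed)) * ((C1 * C2 * (Aj * Dj)) / (G1 * G2 * Dk)) * (b / a) ^+ J.
  rewrite /alpha1 -/J prodf_div.
  have -> : \prod_(r < n) qpfact q p (d / x r) (J%:Z - (k r)%:Z) = Dk.
    by apply: eq_bigr => r _; rewrite qpfactB.
  have -> : \prod_(r < n) \prod_(s < n) (qpfact q p (q * x r / x s) (k r) *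
      qpfact q p (a * x r * x s * q / d) (k r)) = Ka * Ed.
    rewrite -big_split; apply: eq_bigr => r _; rewrite -big_split; apply: eq_bigr => s _.
    by rewrite ex.
  have -> : \prod_(r < n) \prod_(s < n | (r < s)%N)
      qpfact q p (a * x r * x s * q / d) (k r + k s)%N = Pk.
    by apply: eq_bigr => r _; apply: eq_bigr => s _; rewrite ex.
  have -> : \prod_(r < n) (qpfact q p (c * x r) (k r) *
      qpfact q p (a ^+ 2 * x r * q / (b * c * d)) (k r) *
      (qpfact q p (a * x r) J * qpfact q p (d / x r) J)) = C1 * C2 * (Aj * Dj).
    rewrite !big_split; congr (_ * _ * _); apply: eq_bigr => r _.
    rewrite qpfactE; congr (sh _ _); rewrite /e; field.
    by rewrite b0 c0 d0.
  by [].
pose G1' := sh (a * q ^+ J.+1 / c) (M - J).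
pose G2' := sh (b * c * q ^+ J.+1 / e) (M - J).
pose Wb := \prod_(r < n) sh (b * x r) M.
pose H := \prod_(r < n) \prod_(s < n) sh (q * x r / x s) (N r).
pose EE := \prod_(t in seg k) th (e * y t * y t).
pose AA := \prod_(t in seg k) th (a * q ^+ J * y t).
pose OO := \prod_(t in [set: cell] :\: seg k) th (a * q ^+ J.+1 * y t).
pose Dp := \prod_(t in seg k) th (a * q ^+ J / (e * y t)).
pose Ep := \prod_(t in seg k) th (b * q ^+ M * y t).
pose PP := pair_prod (seg k) (pair_weight th q y e).
have G1E : sh (a * q / c) M = G1 * G1'.
  rewrite -(subnKC JM) (@shiftedE _ th q _ (a * q ^+ J.+1 / c)) // => i.
  by rewrite exprD exprS; ring.
have G2E : sh (b * c * d / a) M = G2 * G2'.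
  rewrite -(subnKC JM) (@shiftedE _ th q _ (b * c * q ^+ J.+1 / e)) // => i.
  by rewrite exprD exprS /e; field; rewrite a0 d0 q0.
have termE : subset_term th q y a e [set: cell] b c (seg k) =
   S * (b / a) ^+ J * (G1' * G2') * (C1 * C2 * (Dp * Ep / (EE * AA))) * OO^-1 *
   (H / (Ka * Bd)) * PP.
  rewrite /subset_term cardM cardJ /S /G1' /G2' prodfV.
  rewrite (prod_seg_cseg q0 x0 thx kN) -/y -/PP -/H -/OO.
  congr (_ * _ * _ * (_ / _) * _).
    rewrite !big_split /= prodfV big_split /= -/EE -/AA -/Dp -/Ep.
    rewrite (prod_seg_shifted _ _ _ _ kN) -/C1; congr (_ * _ * _).
    rewrite /C2 -(prod_seg_shifted _ _ _ _ kN); apply: eq_bigr => t _; congr th.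
    by rewrite /y; ring.
  by rewrite -big_split; apply: eq_bigr => r _; rewrite -big_split.
have f1 : Wb * Ep = Bn by exact: prod_seg_tail.
have f2 : Dk * Dp = Dj.
  have h := prod_seg_rev th q0 x0 kJ kN (erefl (d * q ^+ J / q)).
  rewrite /Dj -h; congr (_ * _); apply: eq_bigr => t _; congr th.
  by rewrite /e -/(y t); field; rewrite ?a0 ?d0 ?q0 ?y_neq0.
have f3 : AA * OO * (T1 * Aj) = T0 * An by exact: prod_poised.
have f4 : PP / EE = Pk / Ed by exact: prod_seg_pairs.
have n0 : Bd != 0.
  apply: prod_neq0 => r; apply: prod_neq0 => s; apply: shifted_neq0 => i.
  have -> : q ^ (1 + (k r)%:Z - (k s)%:Z) * x r / x s * q ^+ i =
      q ^ (1 + (k r)%:Z - (k s)%:Z + i%:Z) * x r / x s.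
    by rewrite [in RHS]expfzDr // -exprnP; ring.
  by apply: thx; have [->|//] := eqVneq r s; lia.
have n1 : EE != 0 by apply: prod_neq0 => t; exact: theyy.
have thay m t : th (a * q ^+ m * y t) != 0.
  rewrite /y /node (_ : _ * _ = a * x (tag t) * q ^+ (m + tagged t)) ?thax //.
  by rewrite exprD; ring.
have n2 : AA != 0 by apply: prod_neq0 => t; exact: thay.
have n3 : OO != 0 by apply: prod_neq0 => t; exact: thay.
have n4 : T1 != 0 by apply: prod_neq0 => r; exact: thax.
have n5 : Aj != 0 by apply: prod_neq0 => r; apply: shifted_neq0 => i; exact: thax.
have n6 : T0 != 0 by apply: prod_neq0 => r; have := thax r 0; rewrite expr0 mulr1.
have n7 : An != 0.
  apply: prod_neq0 => r; apply: shifted_neq0 => i.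
  by rewrite -mulrA -exprS; exact: thax.
have n8 : Ed != 0 by apply: prod_neq0 => r; apply: prod_neq0 => s; exact: shex_neq0.
have n9 : Ka != 0 by apply: prod_neq0 => r; apply: prod_neq0 => s; exact: shqx_neq0.
have n10 : H != 0 by apply: prod_neq0 => r; apply: prod_neq0 => s; exact: shqx_neq0.
have n11 : Dk != 0 by apply: prod_neq0 => r.
have [n12 n13] : G1 != 0 /\ G1' != 0 by apply/andP; rewrite -negb_or -mulf_eq0 -G1E.
have [n14 n15] : G2 != 0 /\ G2' != 0 by apply/andP; rewrite -negb_or -mulf_eq0 -G2E.
rewrite BE aE termE /prefactor -/Wb -/H G1E G2E -f1 -f2.
have {f4}-> : PP = Pk / Ed * EE by rewrite -f4 divfK.
have {f3}-> : An = AA * OO * (T1 * Aj) / T0 by rewrite f3 mulrC mulKf.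
exact: regroup.
Qed.

End Assembly.

(** * The WP Bailey pair *)

(** Kills the subsets that are not unions of initial segments. *)
Lemma subset_term_zero (K : fieldType) (th : K -> K) (q : K) (T : finType) (y : T -> K)
    (a e : K) (S : {set T}) (b c : K) (I : {set T}) (t u : T) : th 1 = 0 ->
  t \in I -> u \in S -> u \notin I -> y t != 0 -> q * y u = y t ->
  subset_term th q y a e S b c I = 0.
Proof.
move=> th1 tI uS uI yt qy; rewrite /subset_term.
rewrite [\prod_(i in I) \prod_(j in S :\: I) _](_ : _ = 0) ?mulr0 ?mul0r //.
rewrite (bigD1 t) //= (bigD1 u) /=; last by rewrite inE uI.
by rewrite qy divff // th1 !mul0r.
Qed.

Lemma shifted_factor_neq0 (K : fieldType) (th : K -> K) (q u : K) m i :
  shifted th q u m != 0 -> (i < m)%N -> th (u * q ^+ i) != 0.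
Proof.
rewrite /shifted prodf_seq_neq0 => /allP h im.
by apply: (h i); rewrite mem_index_iota im.
Qed.

Lemma WP_Bailey_pair_complexField (R : realType) (q p : complexField R) (n : nat)
    (x : 'I_n -> complexField R) (a b c d : complexField R) :
  q != 0 -> cmod p < 1 -> (forall r, x r != 0) ->
  a != 0 -> b != 0 -> c != 0 -> d != 0 ->
  B1_generic q p x a -> alpha1_generic q p x c d a b -> beta1_generic q p x c d a b ->
  WP_Bailey_pair (B1 q p x) (alpha1 q p x c d) (beta1 q p x c d) a b.
Proof.
move=> q0 p1 x0 a0 b0 c0 d0 gB ga gb N.
pose e := a * q / d.
have e0 : e != 0 by rewrite !mulf_neq0 ?invr_eq0.
have th1 := theta1 p1.
have thqpos r m : theta p (q ^+ m.+1 * x r / x r) != 0.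
  have [|h _] := gB (fun=> m.+1) (fun=> 0%N); first by [].
  have := @shifted_factor_neq0 _ _ _ _ _ m (h r r) (leq_addr _ _).
  by rewrite subr0 addr0 expr1z exprS; congr (theta p _ != 0); ring.
have thx r s (m : int) : (r != s) || (m != 0) -> theta p (q ^ m * x r / x s) != 0.
  have [<-|rs] := eqVneq r s => /= m0.
    case: m m0 => [[|m]|m] // _; first exact: thqpos.
    have -> : q ^ Negz m * x r / x r = (q ^+ m.+1 * x r / x r)^-1.
      by rewrite !mulfK // NegzE -exprz_inv -exprnP exprVn.
    rewrite (thetaV p1) ?mulfK ?expf_neq0 // mulf_neq0 ?oppr_eq0 ?invr_eq0 ?expf_neq0 //.
    by have := thqpos r m; rewrite mulfK.
  have [u [v ->]] : exists u v : nat, m = u%:Z - v%:Z.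
    by case: m m0 => m _; [exists m, 0%N|exists 0%N, m.+1]; rewrite ?subr0 ?NegzE ?sub0r.
  (* Then 1 + j_r - j_s = u - v, and a single theta is left for k = j + 1. *)
  pose j i := if i == r then u else v.+1.
  have [|h _] := gB (fun i => (j i + 1)%N) j; first by move=> i; exact: leq_addr.
  have sr : (s == r) = false by rewrite eq_sym (negbTE rs).
  have := h r s; rewrite /j eqxx sr.
  have -> : 1 + u%:Z - v.+1%:Z = u%:Z - v%:Z by lia.
  have -> : (u + 1)%N%:Z - u%:Z = 1%N%:Z by lia.
  by move=> h1; have := @shifted_factor_neq0 _ _ _ _ _ 0 h1 isT; rewrite expr0 mulr1.
have thex r s m : theta p (e * x r * x s * q ^+ m) != 0.
  have [_ h _ _ _] := ga (fun=> m.+1); have [_ h'] := h r s.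
  have := @shifted_factor_neq0 _ _ _ _ _ m h' (ltnSn m).
  by congr (theta p _ != 0); rewrite /e; ring.
have thax r m : theta p (a * x r * q ^+ m) != 0.
  case: m => [|m]; first by rewrite expr0 mulr1; have [h _ _ _ _] := ga (fun=> 0%N).
  have [|_ h] := gB (fun=> m.+1) (fun=> 0%N); first by [].
  have := @shifted_factor_neq0 _ _ _ _ _ m (h r) (leq_addr _ _).
  by congr (theta p _ != 0); rewrite exprS; ring.
have [_ _ shc shd _] := ga N.
have le_sum (k : multiindex n) r : (k r <= mindex_sum k)%N.
  by rewrite /mindex_sum (bigD1 r) //= leq_addr.
have shz r : shifted (theta p) q (b * d / a / x r) (mindex_sum N - N r) != 0.
  have -> : b * d / a / x r = b * d / (a * x r) by rewrite invfM mulrA.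
  by rewrite -qpfactB ?le_sum //; have [_ /(_ r) h _ _] := gb N.
rewrite (beta1_subset_total q0 x0 a0 b0 c0 d0 thx thex shc shd shz).
pose y := node q x (N := N).
have y0 t : y t != 0 by exact: y_neq0.
have thy s t : s != t -> theta p (y t / y s) != 0.
  move=> st; have -> : y t / y s = q ^ ((tagged t)%:Z - (tagged s)%:Z) * x (tag t) / x (tag s).
    rewrite /y /node expfzDr // -exprz_inv -!exprnP exprVn; field.
    by rewrite x0 expf_neq0.
  apply: thx; case: s t st => [r u] [r' v] /= st.
  have [rr|//] := eqVneq r' r; subst r'; rewrite /= subr_eq0.
  by apply: contraNneq st => -[uv]; apply/eqP; congr existT; apply: val_inj.
have they s t : theta p (e * y s * y t) != 0.
  have -> : e * y s * y t = e * x (tag s) * x (tag t) * q ^+ (tagged s + tagged t).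
    by rewrite /y /node exprD; ring.
  exact: thex.
have thay k t : theta p (a * q ^+ k * y t) != 0.
  have -> : a * q ^+ k * y t = a * x (tag t) * q ^+ (k + tagged t).
    by rewrite /y /node exprD; ring.
  exact: thax.
rewrite -(subset_identity p1 q0 a0 e0 y0 thy they thay _ b0 c0) mulr_sumr.
rewrite sum_segments => [|I t u tI uI rtu utt]; last first.
  rewrite (@subset_term_zero _ _ _ _ _ _ _ _ _ _ _ t u) ?mulr0 ?inE //.
  by rewrite /y /node -utt rtu exprS; ring.
apply: eq_bigr => j _.
have jN r : (j r <= N r)%N by rewrite -ltnS.
have shdx r : shifted (theta p) q (d / x r) (mindex_sum (fun r => j r) - j r) != 0.
  have [_ _ _ _ /(_ r)] := ga (fun r => j r).
  by rewrite (qpfactB _ _ _ (le_sum (fun r => j r) r)).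
exact: (esym (summand_subset_term q0 x0 a0 b0 c0 d0 thx thex thax shc shd jN shdx)).
Qed.

Theorem theorem7p1 (R : realType) (q p : R[i]) (n : nat) (x : 'I_n -> R[i])
    (a b c d : R[i])
    (hq : q != 0) (hp : `|p| < 1) (hn : (1 <= n)%N)
    (hx : forall r, x r != 0)
    (ha : a != 0) (hb : b != 0) (hc : c != 0) (hd : d != 0)
    (gB : B1_generic q p x a)
    (galpha : alpha1_generic q p x c d a b)
    (gbeta : beta1_generic q p x c d a b) :
  WP_Bailey_pair (B1 q p x) (alpha1 q p x c d) (beta1 q p x c d) a b.
Proof.
apply: (@WP_Bailey_pair_complexField R q p n x a b c d hq _ hx ha hb hc hd gB galpha gbeta).
by rewrite -ltcR -normC_cmod.
Qed.
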